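(* Assume that the action $\Theta:\Omega\to\mathbb{R}$ has a nonsingular Hessian $\nabla^2_{\mu,c,\boldsymbol{\lambda}}\Theta$ at every point of $\Omega$. Then the mapping $(\mu,c,\boldsymbol{\lambda})\mapsto(k,\alpha,\mathbf{M})$ defined on $\Omega$ by $$k=\frac1\Xi,\qquad \alpha=\frac1k\left(\langle\mathcal{Q}(\underline{\mathbf{U}})\rangle-\mathcal{Q}(\langle\underline{\mathbf{U}}\rangle)\right),\qquad \mathbf{M}=\langle\underline{\mathbf{U}}\rangle,$$ is a local diffeomorphism. Moreover: 1. (Locally) as a function of $(k,\alpha,\mathbf{M})$, the averaged Hamiltonian $\mathrm{H}:=\langle\mathcal{H}[\underline{\mathbf{U}}]\rangle$ satisfies $$\partial_k\mathrm{H}=\Theta-\alpha c,\qquad \partial_\alpha\mathrm{H}=-kc,\qquad \nabla_{\mathbf{M}}\mathrm{H}=\langle\delta\mathcal{H}[\underline{\mathbf{U}}]\rangle.$$ 2. The modulated equations have a closed form in the variables $(k,\alpha,\mathbf{M})$: for smooth functions $(X,T)\mapsto(\mu,c,\boldsymbol{\lambda})(X,T)\in\Omega$, with $\underline{\mathbf{U}}(X,T;\cdot)$ the corresponding profiles, $k=1/\Xi$ and $\omega=-kc$, the system $$\partial_Tk-\partial_X\omega=0,\qquad \partial_T\langle\underline{\mathbf{U}}\rangle-\partial_X\langle\mathbf{B}\,\delta\mathcal{H}[\underline{\mathbf{U}}]\rangle=0,\qquad \partial_T\langle\mathcal{Q}(\underline{\mathbf{U}})\rangle-\partial_X\langle\underline{\mathbf{U}}\cdot\delta\mathcal{H}[\underline{\mathbf{U}}]+\mathsf{L}\mathcal{H}[\underline{\mathbf{U}}]\rangle=0$$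 is equivalent to $$\partial_T\begin{pmatrix}k\\ \alpha\\ \mathbf{M}\end{pmatrix}=\begin{pmatrix}0&1&0\\1&0&0\\0&0&\mathbf{B}\end{pmatrix}\partial_X\left(\nabla_{k,\alpha,\mathbf{M}}\mathrm{H}\right).$$
   Context: Let $N\in\{1,2\}$, $b\in\mathbb{R}\setminus\{0\}$, and let $f,\kappa,\tau$ be smooth real functions (on the interval of values of $v$) with $\kappa,\tau>0$. Set $e(v,v_x)=\frac12\kappa(v)v_x^2+f(v)$. If $N=1$: $\mathbf{U}=v$, $\mathcal{H}(\mathbf{U},\mathbf{U}_x)=e(v,v_x)$, $\mathbf{B}=b$. If $N=2$: $\mathbf{U}=(v,u)^{\mathsf T}$, $\mathcal{H}(\mathbf{U},\mathbf{U}_x)=\frac12\tau(v)u^2+e(v,v_x)$, $\mathbf{B}=\begin{pmatrix}0&b\\ b&0\end{pmatrix}$. Set $\mathcal{Q}(\mathbf{U})=\frac12\mathbf{U}\cdot\mathbf{B}^{-1}\mathbf{U}$. The variational derivative is $\delta\mathcal{H}[\mathbf{U}]=\nabla_{\mathbf{U}}\mathcal{H}-\partial_x(\nabla_{\mathbf{U}_x}\mathcal{H})$, and for a density $\mathcal{F}(\mathbf{U},\mathbf{U}_x)$, $\mathsf{L}\mathcal{F}[\mathbf{U}]:=\mathbf{U}_x\cdot\nabla_{\mathbf{U}_x}\mathcal{F}-\mathcal{F}$. For $(\mu,c,\boldsymbol{\lambda})\in\mathbb{R}\times\mathbb{R}\times\mathbb{R}^N$, the profile equations are $$\delta(\mathcal{H}+c\mathcal{Q})[\underline{\mathbf{U}}]+\boldsymbol{\lambda}=0,\qquad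 \mathsf{L}\mathcal{L}[\underline{\mathbf{U}}]=\mu,\qquad \mathcal{L}:=\mathcal{H}(\mathbf{U},\mathbf{U}_x)+c\,\mathcal{Q}(\mathbf{U})+\boldsymbol{\lambda}\cdot\mathbf{U}.$$ $\Omega$ is an open subset of $\mathbb{R}^{N+2}$ and $(\mu,c,\boldsymbol{\lambda})\in\Omega\mapsto(\underline{\mathbf{U}},\Xi)$ is a smooth family (the maps $(\mu,c,\boldsymbol{\lambda},\xi)\mapsto\underline{\mathbf{U}}(\xi)$ and $(\mu,c,\boldsymbol{\lambda})\mapsto\Xi\in(0,\infty)$ are smooth) such that for each parameter value $\underline{\mathbf{U}}$ is a smooth non-constant periodic solution of the profile equations, of fundamental period $\Xi$. The action is $$\Theta(\mu,c,\boldsymbol{\lambda}):=\int_0^\Xi\left(\mathcal{H}[\underline{\mathbf{U}}]+c\,\mathcal{Q}(\underline{\mathbf{U}})+\boldsymbol{\lambda}\cdot\underline{\mathbf{U}}+\mu\right)d\xi,$$ where $\mathcal{H}[\underline{\mathbf{U}}]=\mathcal{H}(\underline{\mathbf{U}},\underline{\mathbf{U}}_\xi)$. The bracket $\langle\cdot\rangle$ denotes the mean value over one period $\Xi$. *)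

(* Defs.v *)
From HB Require Import structures.
From mathcomp Require Import all_boot all_order all_algebra.
From mathcomp Require Import all_classical all_reals all_analysis.
Export numFieldNormedType.Exports.
Export Order.TTheory GRing.Theory Num.Theory.
Set Implicit Arguments.
Unset Strict Implicit.
Unset Printing Implicit Defensive.
Global Open Scope classical_set_scope.
Global Open Scope ring_scope.

Section Calculus.
Context {R : realType}.

(* The spaces used below are all finite-dimensional (R, row vectors, and
   products of these); there, existence and continuity of all iterated
   directional derivatives up to order k is the usual notion of class C^k. *)
Fixpoint Ck_on {E V : normedModType R} (k : nat) (D : set E) (g : E -> V)
    : Prop :=
  (forall x, D x -> {for x, continuous g}) /\
  if k is j.+1 then
    forall v, (forall x, D x -> derivable g x v) /\ Ck_on j D ('D_v g)
  else True.

Definition smooth_on {E V : normedModType R} (D : set E) (g : E -> V) : Prop :=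
  forall k, Ck_on k D g.

(* On the open set V, F is a diffeomorphism onto an open set, with inverse G. *)
Definition diffeo_on {E E' : normedModType R} (V : set E)
    (F : E -> E') (G : E' -> E) : Prop :=
  [/\ open V, open (F @` V), smooth_on V F, smooth_on (F @` V) G
    & forall x, V x -> G (F x) = x].

Definition local_diffeo {E E' : normedModType R} (D : set E) (F : E -> E')
    : Prop :=
  forall x, D x -> exists V G, [/\ V x, V `<=` D & diffeo_on V F G].

Definition dotp {n} (x y : 'rV[R]_n) : R := \sum_i x 0 i * y 0 i.

(* Row vectors stand for column vectors: A acts on x by A x. *)
Definition mxact {n} (A : 'M[R]_n) (x : 'rV[R]_n) : 'rV[R]_n := x *m A^T.

Definition grad {n} (g : 'rV[R]_n -> R) (x : 'rV[R]_n) : 'rV[R]_n :=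
  \row_i 'D_(delta_mx 0 i) g x.

Definition hessian {n} (g : 'rV[R]_n -> R) (x : 'rV[R]_n) : 'M[R]_n :=
  \matrix_(i, j) 'D_(delta_mx 0 i) ('D_(delta_mx 0 j) g) x.

Definition mean (L : R) (g : R -> R) : R :=
  L^-1 * \int[lebesgue_measure]_(x in `[0, L]) g x.

Definition meanv {n} (L : R) (g : R -> 'rV[R]_n) : 'rV[R]_n :=
  \row_i mean L (fun x => g x 0 i).

Definition fundamental_period {V : zmodType} (g : R -> V) (L : R) : Prop :=
  [/\ 0 < L, periodic g L & forall l, 0 < l -> periodic g l -> L <= l].

(* Points of R x R are written (X, T). *)
Definition dX {V : normedModType R} (g : R * R -> V) : R * R -> V :=
  'D_((1, 0) : R * R) g.
Definition dT {V : normedModType R} (g : R * R -> V) : R * R -> V :=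
  'D_((0, 1) : R * R) g.

End Calculus.

(* With N = n.+1 components, U = v for n = 0 and U = (v, u) for n = 1; larger n
   are not used.  In the definitions below a density is a function of
   (U, U_x). *)
Section Model.
Context {R : realType}.
Variables (n : nat) (b : R) (f kappa tau : R -> R).

Definition energy (v vx : R) : R := 2^-1 * kappa v * vx ^+ 2 + f v.

Definition hamiltonian (U Ux : 'rV[R]_n.+1) : R :=
  let v := U 0 ord0 in
  let vx := Ux 0 ord0 in
  let u := U 0 ord_max in
  if n == 0%N then energy v vx else 2^-1 * tau v * u ^+ 2 + energy v vx.

(* (b) for n = 0, and ((0, b), (b, 0)) for n = 1 *)
Definition Bmx : 'M[R]_n.+1 := \matrix_(i, j) if (i + j == n)%N then b else 0.

End Model.

Section Modulation.
Context {R : realType} {n : nat}.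
Local Notation vec := ('rV[R]_n.+1).
(* Parameters (mu, c, lambda), and also the triples (k, alpha, M). *)
Local Notation par := ('rV[R]_(2 + n.+1)).
Implicit Types (p : par) (Ham : vec -> vec -> R) (B : 'M[R]_n.+1).

Definition triple (x y : R) (w : vec) : par :=
  row_mx (\row_(j < 2) if j == 0 then x else y) w.

Definition mu p : R := lsubmx p 0 0.
Definition cc p : R := lsubmx p 0 1.
Definition lam p : vec := rsubmx p.

Definition Qf B (u : vec) : R := 2^-1 * dotp u (mxact (invmx B) u).

Definition varder (F : vec -> vec -> R) (u : R -> vec) (x : R) : vec :=
  grad (fun w => F w (derive1 u x)) (u x) -
  derive1 (fun y => grad (fun w => F (u y) w) (derive1 u y)) x.

Definition Lop (F : vec -> vec -> R) (u : R -> vec) (x : R) : R :=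
  dotp (derive1 u x) (grad (fun w => F (u x) w) (derive1 u x)) - F (u x) (derive1 u x).

Definition profile_equations Ham B p (u : R -> vec) : Prop :=
  (forall x, varder (fun w wx => Ham w wx + cc p * Qf B w) u x + lam p = 0) /\
  (forall x, Lop (fun w wx => Ham w wx + cc p * Qf B w + dotp (lam p) w) u x
             = mu p).

Variables (Ham : vec -> vec -> R) (B : 'M[R]_n.+1).
Variables (U : par -> R -> vec) (Xi : par -> R).

Definition action p : R :=
  \int[lebesgue_measure]_(x in `[0, Xi p])
    (Ham (U p x) (derive1 (U p) x) + cc p * Qf B (U p x) + dotp (lam p) (U p x)
     + mu p).

Definition wavenumber p : R := (Xi p)^-1.

Definition meanU p : vec := meanv (Xi p) (U p).

Definition meanQ p : R := mean (Xi p) (fun x => Qf B (U p x)).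

Definition alpha p : R := (wavenumber p)^-1 * (meanQ p - Qf B (meanU p)).

Definition kaM p : par := triple (wavenumber p) (alpha p) (meanU p).

Definition meanH p : R := mean (Xi p) (fun x => Ham (U p x) (derive1 (U p) x)).

Definition mean_dH p : vec := meanv (Xi p) (varder Ham (U p)).

Definition omega p : R := - (wavenumber p * cc p).

(* The modulated equations at the point z = (X, T), for P(X, T) = (mu, c,
   lambda)(X, T). *)
Definition modulated_eqs (P : R * R -> par) (z : R * R) : Prop :=
  [/\ dT (fun s => wavenumber (P s)) z - dX (fun s => omega (P s)) z = 0,
      dT (fun s => meanU (P s)) z
        - dX (fun s => meanv (Xi (P s))
                (fun x => mxact B (varder Ham (U (P s)) x))) z = 0
    & dT (fun s => meanQ (P s)) z
        - dX (fun s => mean (Xi (P s))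
                (fun x => dotp (U (P s) x) (varder Ham (U (P s)) x)
                          + Lop Ham (U (P s)) x)) z = 0].

Definition closed_mx : 'M[R]_(2 + n.+1) :=
  block_mx (\matrix_(i < 2, j < 2) (i != j)%:R) 0 0 B.

(* Here G is a local inverse of kaM, so that meanH \o G is the averaged
   Hamiltonian as a function of (k, alpha, M). *)
Definition closed_eqs (G : par -> par) (P : R * R -> par) (z : R * R) : Prop :=
  dT (fun s => kaM (P s)) z =
  mxact closed_mx (dX (fun s => grad (meanH \o G) (kaM (P s))) z).

End Modulation.

(* Main.v *)
Require Import Defs.
From HB Require Import structures.
From mathcomp Require Import all_boot all_order all_algebra.
From mathcomp Require Import all_classical all_reals all_analysis.
From mathcomp Require Import perm ring lra.
Import Order.TTheory GRing.Theory Num.Theory.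

(** The proof rests on Whitham's formula for the gradient of the action.  After
rescaling the variable to [y = x / Xi], all profiles have period 1 and the
action can be differentiated under the integral sign.  By the two profile
equations, the derivative of its density in the direction [v] of the parameters
is the explicit one, [Xi (mu v + cc v Q(U) + lam v . U)], plus a total
derivative in [y] ([action_density]); the latter integrates to 0 by periodicity.
Hence ([is_derive_action])
  grad Theta = (Xi, Xi <Q(U)>, Xi <U>).

The triple (k, alpha, M) is an explicit function of this gradient and
determines it.  A direction in which (k, alpha, M) is stationary is therefore in
the kernel of the Hessian of Theta, hence zero ([kaM_immersion]), and the inverse
function theorem ([inverse_function]) gives the local diffeomorphism.

The definition of the action reads [H = k Theta - c <Q> - lam . M - mu]
([meanHE_action]).  Differentiate, insert the gradient of the action and
[<Q> = k alpha + Q(M)]: the terms with the differentials of mu, c and lam cancel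
and there remains ([derive_meanH])
  dH = (Theta - alpha c) dk - k c d(alpha) - (lam + c B^-1 M) . dM,
where [- (lam + c B^-1 M)] is the mean of delta H by the first profile
equation.

Finally, the profile equations turn the averaged fluxes of the modulated
equations into [- k c], [B <delta H>] and [mu - c <Q>].  The first two equations
are then the rows of the closed system for k and M, and in their presence the
third one is k times the row for alpha ([modulated_closed]).

The analysis behind this is developed for the classes C^k defined by iterated
directional derivatives: symmetry of mixed derivatives ([schwarz]),
differentiability of C^1 functions ([C1_differentiable]) and with it the chain
rule, the inverse function theorem by a contraction argument, and
differentiation under the integral sign ([is_derive_integral_param]). *)

Set Implicit Arguments.
Unset Strict Implicit.
Unset Printing Implicit Defensive.
Local Open Scope classical_set_scope.
Local Open Scope ring_scope.

(** * Functions of class C^k *)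

Section CkTheory.
Context {R : realType}.
Implicit Types E V W : normedModType R.

Lemma continuous_Ck E V k (D : set E) (g : E -> V) x :
  Ck_on k D g -> D x -> {for x, continuous g}.
Proof. by case: k => [|k] [+ _] Dx; apply. Qed.

Lemma derivable_Ck E V k (D : set E) (g : E -> V) x v :
  Ck_on k.+1 D g -> D x -> derivable g x v.
Proof. by move=> [_ /(_ v)[+ _]] Dx; apply. Qed.

Lemma Ck_derive E V k (D : set E) (g : E -> V) v :
  Ck_on k.+1 D g -> Ck_on k D ('D_v g).
Proof. by move=> [_ /(_ v)[]]. Qed.

Lemma CkW E V k (D : set E) (g : E -> V) : Ck_on k.+1 D g -> Ck_on k D g.
Proof.
elim: k g => [|k IHk] g [gc gd]; first by split.
split => // v; have [gdv dgv] := gd v; split => //; exact: IHk.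
Qed.

Lemma sub_Ck E V k (D D' : set E) (g : E -> V) :
  D' `<=` D -> Ck_on k D g -> Ck_on k D' g.
Proof.
move=> DD; elim: k g => [|k IHk] g [gc gd]; split => //.
- by move=> x /DD; exact: gc.
- by move=> x /DD; exact: gc.
- move=> v; have [gdv dgv] := gd v; split; last exact: IHk.
  by move=> x /DD; exact: gdv.
Qed.

Lemma near_eq_on {T : topologicalType} {U : Type} (D : set T) (f g : T -> U) x :
  open D -> (forall y, D y -> f y = g y) -> D x -> \forall y \near x, f y = g y.
Proof.
by move=> Do fg Dx; apply: filterS (open_nbhs_nbhs (conj Do Dx)) => y /fg.
Qed.

Lemma eq_derive_on E V (D : set E) (f g : E -> V) x v :
  open D -> (forall y, D y -> f y = g y) -> D x -> 'D_v f x = 'D_v g x.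
Proof. by move=> Do fg Dx; apply: near_eq_derive; exact: near_eq_on Do fg Dx. Qed.

Lemma eq_Ck E V k (D : set E) (f g : E -> V) : open D ->
  (forall x, D x -> f x = g x) -> Ck_on k D f -> Ck_on k D g.
Proof.
move=> Do; have ceq : forall f g : E -> V, (forall x, D x -> f x = g x) ->
    (forall x, D x -> {for x, continuous f}) ->
    forall x, D x -> {for x, continuous g}.
  move=> {}f {}g fg fc x Dx; rewrite /prop_for /continuous_at -fg//.
  apply: cvg_trans (fc x Dx); apply: near_eq_cvg.
  by apply: near_eq_on Do _ Dx => y /fg.
elim: k f g => [|k IHk] f g fg [fc fd]; split => //.
- exact: ceq fg fc.
- exact: ceq fg fc.
- move=> v; have [fdv dfv] := fd v; split.
    move=> x Dx; apply: near_eq_derivable (fdv x Dx).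
    exact: near_eq_on Do fg Dx.
  by apply: IHk dfv => x Dx; exact: eq_derive_on Do fg Dx.
Qed.

(** The closure properties below rest on this criterion: on [D] the derivative of a
product, inverse or composite is given by a formula to which the induction
hypothesis applies, while off [D] the formula may fail. *)
Lemma CkS E V k (D : set E) (g : E -> V) : open D ->
  (forall x, D x -> {for x, continuous g}) ->
  (forall v, exists2 dg, forall x, D x -> is_derive x v g (dg x)
                         & Ck_on k D dg) ->
  Ck_on k.+1 D g.
Proof.
move=> Do gc gd; split => // v; have [dg dgP dgk] := gd v; split.
  by move=> x /dgP[].
by apply: eq_Ck dgk => // x /dgP dgx; rewrite derive_val.
Qed.

Lemma is_derive_Ck E V k (D : set E) (g : E -> V) x v :
  Ck_on k.+1 D g -> D x -> is_derive x v g ('D_v g x).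
Proof. by move=> gk Dx; apply: derivableP; exact: derivable_Ck gk Dx. Qed.

Lemma Ck_cst E V k (D : set E) (a : V) : open D -> Ck_on k D (cst a).
Proof.
move=> Do; elim: k a => [|k IHk] a.
  by split => // x _; exact: cst_continuous.
apply: CkS => // [x _|v]; first exact: cst_continuous.
by exists (cst 0) => // x _; exact: is_derive_cst.
Qed.

Lemma CkD E V k (D : set E) (f g : E -> V) : open D ->
  Ck_on k D f -> Ck_on k D g -> Ck_on k D (f \+ g).
Proof.
move=> Do; elim: k f g => [|k IHk] f g fk gk.
  by split=> // x Dx; apply: continuousD; apply: continuous_Ck Dx; eassumption.
apply: CkS => // [x Dx|v].
  by apply: continuousD; apply: continuous_Ck Dx; eassumption.
exists ('D_v f \+ 'D_v g); last by apply: IHk; exact: Ck_derive.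
by move=> x Dx; exact: (is_deriveD (is_derive_Ck v fk Dx) (is_derive_Ck v gk Dx)).
Qed.

Lemma CkM E k (D : set E) (f g : E -> R) : open D ->
  Ck_on k D f -> Ck_on k D g -> Ck_on k D (f \* g).
Proof.
move=> Do; elim: k f g => [|k IHk] f g fk gk.
  by split=> // x Dx; apply: continuousM; apply: continuous_Ck Dx; eassumption.
apply: CkS => // [x Dx|v].
  by apply: continuousM; apply: continuous_Ck Dx; eassumption.
exists ((f \* 'D_v g) \+ (g \* 'D_v f)).
  by move=> x Dx; exact: (is_deriveM (is_derive_Ck v fk Dx) (is_derive_Ck v gk Dx)).
by apply: CkD => //; apply: IHk => //; (exact: CkW || exact: Ck_derive).
Qed.

Lemma Ck_sum E V k (D : set E) (I : Type) (r : seq I) (P : pred I)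
    (f : I -> E -> V) : open D -> (forall i, Ck_on k D (f i)) ->
  Ck_on k D (fun x => \sum_(i <- r | P i) f i x).
Proof.
move=> Do fk; elim: r => [|i r IHr].
  by apply: eq_Ck (Ck_cst k 0 Do) => // x _; rewrite big_nil.
case Pi : (P i).
  by apply: eq_Ck (CkD Do (fk i) IHr) => // x _; rewrite /= big_cons Pi.
by apply: eq_Ck IHr => // x _; rewrite /= big_cons Pi.
Qed.

Lemma Ck_prod E k (D : set E) (I : Type) (r : seq I) (P : pred I)
    (f : I -> E -> R) : open D -> (forall i, Ck_on k D (f i)) ->
  Ck_on k D (fun x => \prod_(i <- r | P i) f i x).
Proof.
move=> Do fk; elim: r => [|i r IHr].
  by apply: eq_Ck (Ck_cst k (1 : R) Do) => // x _; rewrite big_nil.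
case Pi : (P i).
  by apply: eq_Ck (CkM Do (fk i) IHr) => // x _; rewrite /= big_cons Pi.
by apply: eq_Ck IHr => // x _; rewrite /= big_cons Pi.
Qed.

Lemma CkV E k (D : set E) (f : E -> R) : open D ->
  (forall x, D x -> f x != 0) -> Ck_on k D f -> Ck_on k D (fun x => (f x)^-1).
Proof.
move=> Do f0; elim: k => [|k IHk] fk.
  split=> // x Dx; apply: continuousV; first exact: f0.
  by apply: continuous_Ck Dx; eassumption.
apply: CkS => // [x Dx|v].
  apply: continuousV; first exact: f0.
  by apply: continuous_Ck Dx; eassumption.
have fVk := IHk (CkW fk).
exists (fun x => - 1 * ((f x)^-1 * (f x)^-1 * 'D_v f x)).
  move=> x Dx; have fd : derivable f x v by exact: derivable_Ck fk Dx.
  split; first by apply: derivableV => //; exact: f0.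
  by rewrite deriveV ?f0//= expr2 invfM scaleNr mulN1r.
have := CkM Do (CkM Do fVk fVk) (Ck_derive v fk).
exact: CkM (Ck_cst k (-1 : R) Do).
Qed.

Lemma continuous_mxP E m n (g : E -> 'M[R]_(m, n)) x :
  {for x, continuous g} <-> forall i j, {for x, continuous (fun y => g y i j)}.
Proof.
split=> [gx i j|gx].
  exact: (continuous_comp gx (@coord_continuous R m n i j (g x))).
apply/cvgrPdist_le => /= e e0; near=> y.
rewrite [leLHS]/Num.Def.normr/= mx_normrE (bigmax_le _ (ltW e0))//= => i _.
rewrite !mxE/=; move: i; near: y; apply: filter_forall => /= i.
exact: ((cvgrPdist_le _ _).1 (gx i.1 i.2)).
Unshelve. all: by end_near. Qed.

Lemma Ck_mxP E k (D : set E) m n (g : E -> 'M[R]_(m, n)) : open D ->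
  Ck_on k D g <-> forall i j, Ck_on k D (fun x => g x i j).
Proof.
move=> Do; elim: k g => [|k IHk] g; split=> gk.
- move=> i j; split=> // x Dx.
  by have /continuous_mxP := continuous_Ck gk Dx; apply.
- split=> // x Dx; apply/continuous_mxP => i j.
  exact: continuous_Ck (gk i j) Dx.
- move=> i j; apply: CkS => // [x Dx|v].
    by have /continuous_mxP := continuous_Ck gk Dx; apply.
  exists (fun x => 'D_v g x i j); last exact: (IHk _).1 (Ck_derive v gk) i j.
  move=> x Dx; have gd : derivable g x v by exact: derivable_Ck gk Dx.
  split.
    by have /derivable_mxP := gd; apply.
  by rewrite derive_mx// mxE.
- apply: CkS => // [x Dx|v].
    by apply/continuous_mxP => i j; exact: continuous_Ck (gk i j) Dx.
  exists (fun x => \matrix_(i, j) 'D_v (fun y => g y i j) x).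
    move=> x Dx; have gd : derivable g x v.
      by apply/derivable_mxP => i j; exact: derivable_Ck (gk i j) Dx.
    by split => //; rewrite derive_mx.
  apply/IHk => i j; apply: eq_Ck (Ck_derive v (gk i j)) => // x _.
  by rewrite mxE.
Qed.

Lemma is_derive_comp_linear E E' V (f : {linear E -> E'}) (g : E' -> V) x v dg :
  is_derive (f x) (f v) g dg -> is_derive x v (g \o f) dg.
Proof.
move=> gd; have eqg : (fun h : R => h^-1 *: ((g \o f \o shift x) (h *: v) - (g \o f) x))
    = (fun h => h^-1 *: ((g \o shift (f x)) (h *: f v) - g (f x))).
  by apply/funext => h /=; rewrite (linearP f).
split; first by rewrite /derivable eqg; exact: ex_derive.
by rewrite /derive eqg; exact: derive_val.
Qed.

Lemma Ck_comp_linear E E' V k (D : set E') (f : {linear E -> E'}) (g : E' -> V) :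
  continuous f -> open D -> Ck_on k D g -> Ck_on k (f @^-1` D) (g \o f).
Proof.
move=> fc Do; have fDo : open (f @^-1` D) by apply: open_comp => // x _; exact: fc.
elim: k g => [|k IHk] g gk.
  split=> // x Dx; apply: continuous_comp; first exact: fc.
  exact: continuous_Ck gk Dx.
apply: CkS => // [x Dx|v].
  by apply: continuous_comp; [exact: fc|exact: continuous_Ck gk Dx].
exists ('D_(f v) g \o f); last exact/IHk/Ck_derive.
move=> x Dx; apply: is_derive_comp_linear; exact: is_derive_Ck gk Dx.
Qed.

Lemma Ck_linear E V k (D : set E) (f : {linear E -> V}) :
  open D -> continuous f -> Ck_on k D f.
Proof.
move=> Do fc; case: k => [|k]; first by split=> // x _; exact: fc.
apply: CkS => // [x _|v]; first exact: fc.
exists (cst (f v)); last exact: Ck_cst.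
move=> x _; apply: (@is_derive_comp_linear E V V f id).
Qed.

End CkTheory.

(** * The mean value theorem and mixed derivatives *)

Section MeanValue.
Context {R : realType}.
Implicit Types E V W : normedModType R.

Lemma is_derive_line E V (g : E -> V) (x v : E) (s : R) dg :
  is_derive (s *: v + x) v g dg -> is_derive s 1 (fun t => g (t *: v + x)) dg.
Proof.
move=> gd; have eqg :
    (fun h : R => h^-1 *: (((fun t => g (t *: v + x)) \o shift s) (h *: 1)
                           - g (s *: v + x))) =
    (fun h => h^-1 *: ((g \o shift (s *: v + x)) (h *: v) - g (s *: v + x))).
  by apply/funext => h /=; rewrite [_ *: 1]mulr1 scalerDl addrA.
split; first by rewrite /derivable eqg; exact: ex_derive.
by rewrite /derive eqg; exact: derive_val.
Qed.

Lemma is_derive_from_line E V (g : E -> V) (x v : E) dg :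
  is_derive (0 : R) 1 (fun t => g (t *: v + x)) dg -> is_derive x v g dg.
Proof.
move=> [gd <-]; split; first exact/derivable1P.
rewrite /derive; set q1 := fun h : R => _; set q2 := fun h : R => _.
suff -> : q1 = q2 by [].
by apply/funext => t; rewrite /q1 /q2 /= addr0 scale0r add0r [t *: 1]mulr1.
Qed.

Lemma mean_value E (g : E -> R) (x v : E) (s : R) :
  (forall t : R, `|t| <= `|s| -> derivable g (t *: v + x) v) ->
  exists2 t : R, `|t| <= `|s| &
    g (s *: v + x) - g x = s * 'D_v g (t *: v + x).
Proof.
move=> gd; pose phi t := g (t *: v + x).
have dphi (t : R) : `|t| <= `|s| -> is_derive t 1 phi ('D_v g (t *: v + x)).
  by move=> ts; apply: is_derive_line; apply: derivableP; exact: gd.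
have cphi a b : (forall t : R, t \in `[a, b] -> `|t| <= `|s|) ->
    {within `[a, b], continuous phi}.
  move=> ab; apply: derivable_within_continuous => t /ab ts.
  by have [] := dphi _ ts.
have [s0|s0] := lerP 0 s.
  have ns t : t \in `[0, s] -> `|t| <= `|s|.
    by rewrite in_itv/= => /andP[t0 ts]; rewrite !ger0_norm.
  have [t /ns ts H] := MVT_segment s0
    (fun t ts => dphi t (ns t (subset_itv_oo_cc ts))) (cphi _ _ ns).
  by exists t => //; move: H; rewrite /phi scale0r add0r subr0 mulrC.
have ns t : t \in `[s, 0] -> `|t| <= `|s|.
  by rewrite in_itv/= => /andP[st t0]; rewrite !ler0_norm ?lerN2// ltW.
have [t /ns ts H] := MVT_segment (ltW s0)
  (fun t ts => dphi t (ns t (subset_itv_oo_cc ts))) (cphi _ _ ns).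
exists t => //; move: H; rewrite /phi scale0r add0r => H.
by rewrite -opprB H; ring.
Qed.

Lemma is_derive_translate E V (g : E -> V) (a x v : E) dg :
  is_derive (a + x) v g dg -> is_derive x v (fun y => g (a + y)) dg.
Proof.
move=> gd; have eqg :
    (fun h : R => h^-1 *: (((fun y => g (a + y)) \o shift x) (h *: v)
                           - g (a + x))) =
    (fun h => h^-1 *: ((g \o shift (a + x)) (h *: v) - g (a + x))).
  by apply/funext => h /=; rewrite addrCA.
split; first by rewrite /derivable eqg; exact: ex_derive.
by rewrite /derive eqg; exact: derive_val.
Qed.

(** The second difference of [g] along [u] and [w], divided by [s ^+ 2], is a
value of the mixed derivative: apply the mean value theorem along [u] to
the increment of [g] along [w], then along [w] to the derivative of [g]. *)
Lemma second_difference E (D : set E) (g : E -> R) x u w (s : R) :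
  open D -> Ck_on 2 D g ->
  (forall a b : R, `|a| <= `|s| -> `|b| <= `|s| -> D (a *: u + (b *: w + x))) ->
  exists a b : R, [/\ `|a| <= `|s|, `|b| <= `|s| &
    g (s *: u + (s *: w + x)) - g (s *: u + x) - g (s *: w + x) + g x =
    s * (s * 'D_w ('D_u g) (a *: u + (b *: w + x)))].
Proof.
move=> Do g2 sD.
have D0 (a : R) : `|a| <= `|s| -> D (a *: u + x).
  by move=> /sD /(_ (_ : `|0| <= _)); rewrite normr0 scale0r add0r; apply.
have dG (a : R) : `|a| <= `|s| -> is_derive (a *: u + x) u
   (fun y => g (s *: w + y) - g y)
   ('D_u g (s *: w + (a *: u + x)) - 'D_u g (a *: u + x)).
  move=> sa; apply: is_deriveB.
    apply: is_derive_translate; apply: is_derive_Ck g2 _.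
    by rewrite addrCA; exact: sD.
  by apply: is_derive_Ck g2 _; exact: D0.
have [|a sa] := @mean_value E (fun y => g (s *: w + y) - g y) x u s.
  by move=> t /dG[].
have -> : 'D_u (fun y => g (s *: w + y) - g y) (a *: u + x) =
   'D_u g (s *: w + (a *: u + x)) - 'D_u g (a *: u + x).
  by have [_ ->] := dG _ sa.
have [|b sb ->] := @mean_value E ('D_u g) (a *: u + x) w s.
  move=> t st; apply: derivable_Ck (Ck_derive u g2) _.
  by rewrite addrCA; exact: sD.
move=> gE; exists a, b; split; [exact: sa|exact: sb|].
rewrite [a *: u + _]addrCA -gE.
by rewrite [s *: u + (_ + _)]addrCA; ring.
Qed.

(** Equality of mixed derivatives: the second difference is symmetric in the
two directions, and its values at small steps determine both derivatives. *)
Lemma schwarz E (D : set E) (g : E -> R) x u w : open D -> Ck_on 2 D g ->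
  D x -> 'D_u ('D_w g) x = 'D_w ('D_u g) x.
Proof.
move=> Do g2 Dx; apply/eqP; rewrite -subr_eq0 -normr_le0; apply/ler_addgt0Pl => e e0.
rewrite addr0.
have cts v1 v2 : {for x, continuous ('D_v1 ('D_v2 g))}.
  by apply: continuous_Ck (Ck_derive v1 (Ck_derive v2 g2)) Dx.
have e20 : 0 < e / 2 by rewrite divr_gt0.
have /nbhs_ballP[r /= r0 rP] : \forall y \near x,
    [/\ D y, `|'D_u ('D_w g) x - 'D_u ('D_w g) y| < e / 2
     & `|'D_w ('D_u g) x - 'D_w ('D_u g) y| < e / 2].
  have Dn : nbhs x D := open_nbhs_nbhs (conj Do Dx).
  apply: filterS3 Dn ((cvgrPdist_lt _ _).1 (cts u w) _ e20)
    ((cvgrPdist_lt _ _).1 (cts w u) _ e20) => y Dy H1 H2.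
  by split; [exact: Dy|exact: H1|exact: H2].
pose s := r / (`|u| + `|w| + 1).
have s0 : 0 < s by rewrite divr_gt0// ltr_wpDl// addr_ge0.
have sP v1 v2 (a b : R) : `|v1| + `|v2| = `|u| + `|w| ->
    `|a| <= `|s| -> `|b| <= `|s| -> ball x r (a *: v1 + (b *: v2 + x)).
  move=> vE sa sb; rewrite -ball_normE /ball_/= addrA opprD addrCA subrr addr0 normrN.
  rewrite (le_lt_trans (ler_normD _ _))// !normrZ.
  rewrite (@le_lt_trans _ _ (s * (`|v1| + `|v2|)))//.
    by rewrite mulrDr lerD// ler_wpM2r// (le_trans (_ : _ <= `|s|))// ger0_norm// ltW.
  rewrite vE /s mulrAC ltr_pdivrMr ?ltr_wpDl ?addr_ge0//.
  by rewrite ltr_pM2l// ltrDl.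
have [a [b [sa sb H1]]] : exists a b : R, [/\ `|a| <= `|s|, `|b| <= `|s| & _] :=
  second_difference Do g2 (fun a b sa sb =>
    let: And3 Dy _ _ := rP _ (sP u w a b erefl sa sb) in Dy).
have [a' [b' [sa' sb' H2]]] : exists a b : R, [/\ `|a| <= `|s|, `|b| <= `|s| & _] :=
  second_difference Do g2 (fun a b sa sb =>
    let: And3 Dy _ _ := rP _ (sP w u a b (addrC _ _) sa sb) in Dy).
have [_ _ A1] := rP _ (sP u w a b erefl sa sb).
have [_ A2 _] := rP _ (sP w u a' b' (addrC _ _) sa' sb').
have E12 : 'D_w ('D_u g) (a *: u + (b *: w + x)) =
           'D_u ('D_w g) (a' *: w + (b' *: u + x)).
  have sn0 : s != 0 by rewrite gt_eqF.
  apply: (mulfI sn0); apply: (mulfI sn0); refine (etrans (esym H1) (etrans _ H2)).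
  by rewrite [s *: w + (_ + _)]addrCA; congr (_ + _); exact: addrAC.
move: A1 A2; rewrite E12 => A1 A2.
set y := 'D_u _ (a' *: _ + _) in A1 A2.
move: y ('D_u _ x) ('D_w _ x) A1 A2 => y p q A1 A2.
by clear -A1 A2; have := ler_distD y p q; rewrite (distrC y); lra.
Qed.

End MeanValue.

(** * Differentiability of C^1 functions and the chain rule *)

Section Chain.
Context {R : realType}.
Implicit Types E V W : normedModType R.

Lemma rV_norm_leP m (v : 'rV[R]_m) (c : R) : 0 <= c ->
  (forall i, `|v 0 i| <= c) -> `|v| <= c.
Proof.
move=> c0 vc; rewrite [leLHS]/Num.Def.normr/= mx_normrE bigmax_le//= => -[i j] _ /=.
by rewrite ord1.
Qed.

Lemma rV_coord_le m (v : 'rV[R]_m) i : `|v 0 i| <= `|v|.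
Proof.
rewrite [leRHS]/Num.Def.normr/= mx_normrE.
exact: (le_bigmax _ (fun ij => `|v ij.1 ij.2|) (0, i)).
Qed.

Let trunc m (h : 'rV[R]_m) (i : nat) : 'rV[R]_m :=
  \row_(j < m) if (j < i)%N then h 0 j else 0.

Let truncS m (h : 'rV[R]_m) (i : 'I_m) :
  trunc h i.+1 = h 0 i *: delta_mx 0 i + trunc h i.
Proof.
apply/rowP => j; rewrite !mxE eqxx/= ltnS leq_eqVlt.
have [->|ij] := eqVneq j i; first by rewrite eqxx ltnn mulr1 addr0.
by rewrite (inj_eq val_inj) (negbTE ij) mulr0 add0r.
Qed.

(** [dotp] with the arguments exchanged, so that a fixed first argument gives a
linear map. *)
Definition dotL m (a : 'rV[R]_m) (h : 'rV[R]_m) : R := dotp h a.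

Lemma dotL_is_linear m (a : 'rV[R]_m) : linear (dotL a).
Proof.
move=> c u v; rewrite /dotL /dotp scaler_sumr -big_split; apply: eq_bigr => i _.
by rewrite !mxE mulrDl -mulrA.
Qed.

HB.instance Definition _ m (a : 'rV[R]_m) :=
  GRing.isLinear.Build R 'rV[R]_m R _ (dotL a) (dotL_is_linear a).

Lemma dotL_continuous m (a : 'rV[R]_m) : continuous (dotL a).
Proof.
move=> x; have To := @openT 'rV[R]_m.
have H : Ck_on 0 setT (fun h : 'rV[R]_m => \sum_i h 0 i * a 0 i).
  apply: (Ck_sum (f := fun i (h : 'rV[R]_m) => h 0 i * a 0 i) _ _ To) => i.
  split=> // y _; apply: continuousM; first exact: coord_continuous.
  exact: cst_continuous.
exact: (continuous_Ck (x := x) H).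
Qed.

(** Moving from [x] to [x + h] one coordinate at a time, each step is governed
by the mean value theorem, and continuity of the partial derivatives makes
the total error negligible. *)
Lemma C1_expansion m (D : set 'rV[R]_m) (f : 'rV[R]_m -> R) x :
  open D -> Ck_on 1 D f -> D x ->
  f \o shift x = cst (f x) + dotL (grad f x) +o_ (0 : 'rV[R]_m) id.
Proof.
move=> Do f1 Dx; apply/eqaddoP => e e0.
pose e' := e / m.+1%:R; have e'0 : 0 < e' by rewrite divr_gt0.
have Dn : nbhs x D := open_nbhs_nbhs (conj Do Dx).
have gradn : \forall y \near x, forall i : 'I_m,
    `|'D_(delta_mx 0 i) f x - 'D_(delta_mx 0 i) f y| < e'.
  near=> y => i; move: i; near: y; apply: filter_forall => i.
  have cd := continuous_Ck (Ck_derive (delta_mx 0 i) f1) Dx.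
  exact: ((cvgrPdist_lt _ _).1 cd _ e'0).
have [r /= r0 rP] := (nbhs_ballP _ _).1 (filterI Dn gradn).
have rn : \forall h \near (0 : 'rV[R]_m), `|h| < r.
  have /cvgr0_norm_lt := @cvg_id _ (nbhs (0 : 'rV[R]_m)); exact.
apply: filterS rn => h hr.
have hball (v : 'rV[R]_m) : (forall j, `|v 0 j| <= `|h 0 j|) -> ball x r (v + x).
  move=> vh; rewrite -ball_normE /ball_/= opprD addrCA subrr addr0 normrN.
  apply: le_lt_trans hr; apply: rV_norm_leP => // j.
  exact: le_trans (vh j) (rV_coord_le _ _).
have step (i : 'I_m) : `|f (trunc h i.+1 + x) - f (trunc h i + x)
     - h 0 i * 'D_(delta_mx 0 i) f x| <= `|h| * e'.
  have tball (t : R) : `|t| <= `|h 0 i| ->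
      ball x r (t *: delta_mx 0 i + (trunc h i + x)).
    move=> th; rewrite addrA; apply: hball => j; rewrite !mxE eqxx/=.
    have [->|ij] := eqVneq j i; first by rewrite ltnn mulr1 addr0.
    by rewrite mulr0 add0r; case: ifP => // _; rewrite normr0.
  have [t ht] : exists2 t : R, `|t| <= `|h 0 i| & _ :=
    mean_value (fun t ht => derivable_Ck f1 (rP _ (tball t ht)).1).
  rewrite truncS -[_ *: _ + _ + x]addrA => ->.
  rewrite -mulrBr normrM ler_pM ?rV_coord_le//.
  have [_ /(_ i) dlt] := rP _ (tball t ht).
  by rewrite distrC; exact: ltW.
have tel : f (h + x) - f x =
    \sum_(i < m) (f (trunc h i.+1 + x) - f (trunc h i + x)).
  have := @telescope_sumr R 0 m (fun i => f (trunc h i + x)) (leq0n m).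
  rewrite big_mkord => ->; congr (f (_ + x) - f _).
    by apply/rowP => j; rewrite mxE ltn_ord.
  by rewrite -[LHS]add0r; congr (_ + x); apply/rowP => j; rewrite !mxE.
rewrite /= -[(_ - _) h]/(f (h + x) - (f x + dotL (grad f x) h)).
rewrite opprD addrA tel /dotL /dotp -sumrB.
under eq_bigr do rewrite [grad f x 0 _]mxE.
rewrite (le_trans (ler_norm_sum _ _ _))//.
rewrite (le_trans (ler_sum _ (fun i _ => step i)))//.
rewrite sumr_const card_ord -mulr_natr -mulrA [leRHS]mulrC ler_wpM2l//.
by rewrite /e' mulrAC -mulrA ler_piMr ?(ltW e0)// ler_pdivrMr// mul1r ler_nat.
Unshelve. all: by end_near. Qed.

Lemma C1_differentiable m (D : set 'rV[R]_m) (f : 'rV[R]_m -> R) x :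
  open D -> Ck_on 1 D f -> D x ->
  differentiable f x /\ forall v, 'D_v f x = dotp v (grad f x).
Proof.
move=> Do f1 Dx; have fx := C1_expansion Do f1 Dx.
have dfE : 'd f x = dotL (grad f x) :> (_ -> _).
  by apply: diff_unique fx; exact: dotL_continuous.
have df : differentiable f x.
  apply/diff_locallyP; rewrite dfE; split; last exact: fx.
  exact: dotL_continuous.
by split=> // v; rewrite deriveE// dfE.
Qed.

(** Only the outer function has to be differentiable: restricted to a line, the
inner map is a curve, for which derivability is differentiability. *)
Lemma chain_rule E m (D : set 'rV[R]_m) (f : 'rV[R]_m -> R) (g : E -> 'rV[R]_m)
    x v :
  open D -> Ck_on 1 D f -> D (g x) -> derivable g x v ->
  is_derive x v (f \o g) (dotp ('D_v g x) (grad f (g x))).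
Proof.
move=> Do f1 Dgx gd.
have [fd fE] := C1_differentiable Do f1 Dgx.
pose l := fun h : R => g (h *: v + x).
have l0 : l 0 = g x by rewrite /l scale0r add0r.
have ld : is_derive (0 : R) 1 l ('D_v g x).
  by apply: is_derive_line; rewrite scale0r add0r; exact: derivableP.
have ldiff : differentiable l 0 by apply/derivable1_diffP; case: ld.
have fld : differentiable (f \o l) 0.
  by apply: differentiable_comp => //; rewrite l0.
have flE : 'D_1 (f \o l) 0 = dotp ('D_v g x) (grad f (g x)).
  rewrite deriveE// diff_comp//; last by rewrite l0.
  by rewrite /= -(deriveE _ ldiff) l0 -(deriveE _ fd) fE; case: ld => _ ->.
apply: is_derive_from_line; split; last exact: flE.
exact/derivable1_diffP.
Qed.

(** The derivative of the composite is a sum of products of functions of class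
C^(k-1), by the induction hypothesis applied to the partial derivatives of [f]. *)
Lemma Ck_comp E m k (D : set E) (D' : set 'rV[R]_m) (f : 'rV[R]_m -> R)
    (g : E -> 'rV[R]_m) :
  open D -> open D' -> (forall x, D x -> D' (g x)) ->
  Ck_on k D' f -> Ck_on k D g -> Ck_on k D (f \o g).
Proof.
move=> Do D'o DD'; elim: k f => [|k IHk] f fk gk.
  split=> // x Dx; apply: continuous_comp; first exact: continuous_Ck gk Dx.
  exact: continuous_Ck fk (DD' _ Dx).
have f1 : Ck_on 1 D' f by elim: k fk {IHk gk} => // k IHk /CkW.
apply: CkS => // [x Dx|v].
  apply: continuous_comp; first exact: continuous_Ck gk Dx.
  exact: continuous_Ck fk (DD' _ Dx).
exists (fun x => \sum_i 'D_v g x 0 i * ('D_(delta_mx 0 i) f \o g) x).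
  move=> x Dx; apply: is_derive_eq.
    by apply: chain_rule (DD' _ Dx) _ => //; exact: derivable_Ck gk Dx.
  by apply: eq_bigr => i _; rewrite mxE.
apply: Ck_sum => // i; apply: CkM => //; last first.
  by apply: IHk; [exact: Ck_derive|exact: CkW].
exact: ((Ck_mxP _ _ Do).1 (Ck_derive v gk) 0 i).
Qed.

End Chain.

(** * The inverse function theorem *)

(* makes matrices a complete normed module, as the fixed point theorem asks *)
HB.instance Definition _ (R : realType) (m n : nat) :=
  Uniform_isComplete.Build 'M[R]_(m, n) cauchy_cvg.

Section Jacobian.
Context {R : realType}.
Implicit Types E V W : normedModType R.

Lemma Ck_det E k (D : set E) n (A : E -> 'M[R]_n) : open D ->
  Ck_on k D A -> Ck_on k D (fun x => \det (A x)).
Proof.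
move=> Do Ak; apply: (Ck_sum (f := fun (s : 'S_n) x =>
     (-1) ^+ s * \prod_i A x i (s i)) _ _ Do) => s.
apply: CkM => //; first exact: Ck_cst.
apply: Ck_prod => // i; exact: ((Ck_mxP _ _ Do).1 Ak).
Qed.

(** By Cramer's rule the entries of the inverse are quotients of polynomials in
the entries of the matrix. *)
Lemma Ck_invmx E k (D : set E) n (A : E -> 'M[R]_n) : open D ->
  (forall x, D x -> A x \in unitmx) ->
  Ck_on k D A -> Ck_on k D (fun x => invmx (A x)).
Proof.
move=> Do Au Ak; apply/Ck_mxP => // i j.
have adjk : Ck_on k D (fun x => (\adj (A x)) i j).
  apply: (@eq_Ck _ _ _ _ _ (fun x => (-1) ^+ (j + i) * \det (row' j (col' i (A x))))) => //.
    by move=> x _; rewrite mxE.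
  apply: CkM => //; first exact: Ck_cst.
  apply: Ck_det => //; apply/Ck_mxP => // i' j'.
  apply: eq_Ck ((Ck_mxP _ _ Do).1 Ak (lift j i') (lift i j')) => // x _.
  by rewrite !mxE.
apply: eq_Ck (CkM Do (CkV Do _ (Ck_det Do Ak)) adjk) => //.
  by move=> x /Au Ax; rewrite /invmx Ax [RHS]mxE.
by move=> x /Au; rewrite unitmxE unitfE.
Qed.

Lemma mulmx_norm_bound m (A : 'M[R]_m) :
  exists2 C : R, 0 < C & forall v : 'rV[R]_m, `|v *m A| <= C * `|v|.
Proof.
pose C := 1 + \sum_i \sum_j `|A i j|.
have C0 : 0 < C by rewrite ltr_wpDr// sumr_ge0// => i _; rewrite sumr_ge0.
exists C => // v; apply: rV_norm_leP => [|j]; first by rewrite mulr_ge0// ltW.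
rewrite mxE (le_trans (ler_norm_sum _ _ _))//.
rewrite (@le_trans _ _ (\sum_i `|A i j| * `|v|))//.
  by apply: ler_sum => i _; rewrite normrM mulrC ler_wpM2l// rV_coord_le.
rewrite -mulr_suml ler_wpM2r// /C ler_wpDl//; apply: ler_sum => i _.
by rewrite (bigD1 j)//= lerDl sumr_ge0.
Qed.

(** Row vectors act on the left, so the derivative of [F] at [x] along [v] is
[v *m jac F x]. *)
Definition jac m p (F : 'rV[R]_m -> 'rV[R]_p) (x : 'rV[R]_m) : 'M[R]_(m, p) :=
  \matrix_(i, j) 'D_(delta_mx 0 i) (fun y => F y 0 j) x.

Lemma Ck_jac m p k (D : set 'rV[R]_m) (F : 'rV[R]_m -> 'rV[R]_p) : open D ->
  Ck_on k.+1 D F -> Ck_on k D (jac F).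
Proof.
move=> Do Fk; apply/Ck_mxP => // i j.
apply: eq_Ck (Ck_derive (delta_mx 0 i) ((Ck_mxP _ _ Do).1 Fk 0 j)) => //.
by move=> x _; rewrite mxE.
Qed.

Lemma derive_jac m p (D : set 'rV[R]_m) (F : 'rV[R]_m -> 'rV[R]_p) x v :
  open D -> Ck_on 1 D F -> D x -> 'D_v F x = v *m jac F x.
Proof.
move=> Do F1 Dx; rewrite derive_mx; last exact: derivable_Ck F1 Dx.
apply/rowP => j; rewrite !mxE.
have [_ ->] := C1_differentiable Do ((Ck_mxP _ _ Do).1 F1 0 j) Dx.
by apply: eq_bigr => i _; rewrite !mxE.
Qed.

(** The mean value theorem on the segment from [y] to [x], for each component, and
continuity of the Jacobian. *)
Lemma strict_derivative m p (D : set 'rV[R]_m) (F : 'rV[R]_m -> 'rV[R]_p) x0 (e : R) :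
  open D -> Ck_on 1 D F -> D x0 -> 0 < e ->
  exists r : R, [/\ 0 < r, ball x0 r `<=` D &
    forall x y, ball x0 r x -> ball x0 r y ->
      `|F x - F y - (x - y) *m jac F x0| <= e * `|x - y|].
Proof.
move=> Do F1 Dx0 e0.
pose e' := e / m.+1%:R; have e'0 : 0 < e' by rewrite divr_gt0.
have Dn : nbhs x0 D := open_nbhs_nbhs (conj Do Dx0).
have gradn : \forall z \near x0, forall ij : 'I_m * 'I_p,
    `|jac F x0 ij.1 ij.2 - jac F z ij.1 ij.2| < e'.
  near=> z => ij; move: ij; near: z; apply: filter_forall => ij.
  have jc := continuous_Ck ((Ck_mxP _ _ Do).1 (Ck_jac Do F1) ij.1 ij.2) Dx0.
  exact: ((cvgrPdist_lt _ _).1 jc _ e'0).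
have [r /= r0 rP] := (nbhs_ballP _ _).1 (filterI Dn gradn).
have r30 : 0 < r / 3 by rewrite divr_gt0.
(* [mean_value] controls t only through |t| <= 1, so the segment is prolonged
   beyond y by its own length: a third of the radius leaves room for that *)
exists (r / 3); split => //.
  move=> z /(le_ball _) zr; have [] // := rP z (zr _ _).
  by rewrite ler_pdivrMr// ler_peMr ?(ltW r0)// ler1n.
move=> x y; rewrite -ball_normE /ball_/= => xr yr.
have seg (t : R) : `|t| <= `|1 : R| -> ball x0 r (t *: (x - y) + y).
  rewrite normr1 -ball_normE /ball_/= => t1.
  have xy : `|x - y| <= r / 3 + r / 3.
    by rewrite (le_trans (ler_distD x0 _ _))// distrC lerD// ltW.
  rewrite distrC -addrA (le_lt_trans (ler_normD _ _))// normrZ (distrC y).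
  have : `|t| * `|x - y| <= 1 * (r / 3 + r / 3) by rewrite ler_pM.
  by rewrite mul1r => H; clear -H yr r0; lra.
apply: rV_norm_leP => [|j]; first by rewrite mulr_ge0// ltW.
have F1j := (Ck_mxP _ _ Do).1 F1 0 j.
have [t t1] : exists2 t : R, `|t| <= `|1 : R| & _ :=
  mean_value (fun t t1 => derivable_Ck F1j (rP _ (seg t t1)).1).
rewrite scale1r subrK mul1r.
have [Dz jz] := rP _ (seg t t1).
have [_ ->] := C1_differentiable Do F1j Dz.
move=> FE; rewrite !mxE FE /dotp -sumrB.
rewrite (le_trans (ler_norm_sum _ _ _))//.
rewrite (@le_trans _ _ (\sum_(i < m) `|x - y| * e'))//.
  apply: ler_sum => i _; have := jz (i, j); rewrite !mxE/= => jzi.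
  by rewrite -mulrBr normrM ler_pM//; [have := rV_coord_le (x - y) i; rewrite !mxE|
    rewrite distrC ltW].
rewrite sumr_const card_ord -mulr_natr -mulrA [leRHS]mulrC ler_wpM2l//.
by rewrite /e' mulrAC -mulrA ler_piMr ?(ltW e0)// ler_pdivrMr// mul1r ler_nat.
Unshelve. all: by end_near. Qed.

End Jacobian.

Lemma absorb_half (R : realType) (a b c d C : R) :
  b <= 2^-1 * a -> c <= C * d -> a <= b + c -> a <= 2 * C * d.
Proof. lra. Qed.

Section LocalInverse.
Context {R : realType} {m : nat}.
Variables (F : 'rV[R]_m -> 'rV[R]_m) (V : set 'rV[R]_m) (A : 'M[R]_m) (C : R).
Hypothesis Au : A \in unitmx.
Hypothesis C0 : 0 < C.
Hypothesis AVC : forall v : 'rV[R]_m, `|v *m invmx A| <= C * `|v|.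
Hypothesis FA : forall x y, V x -> V y ->
  `|F x - F y - (x - y) *m A| <= (2 * C)^-1 * `|x - y|.

(** The fixed points of Newton's iteration with frozen derivative are the
solutions of [F x = y]. *)
Let newton (y x : 'rV[R]_m) : 'rV[R]_m := x + (y - F x) *m invmx A.

Let newton_contract y x x' : V x -> V x' ->
  `|newton y x - newton y x'| <= 2^-1 * `|x - x'|.
Proof.
move=> Vx Vx'; have -> : newton y x - newton y x' =
    - ((F x - F x' - (x - x') *m A) *m invmx A).
  rewrite /newton [in RHS]mulmxBl mulmxK// opprB opprD addrACA; congr (_ + _).
  by rewrite -[in RHS]mulNmx -mulmxBl; congr (_ *m _); rewrite !opprB addrC subrKA.
rewrite normrN (le_trans (AVC _))//.
have := FA Vx Vx'; rewrite invfM => H.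
have := ler_wpM2l (ltW C0) H.
by rewrite mulrA mulrCA mulfV ?gt_eqF// mulr1.
Qed.

(** The displacement [x - x'] is that of the Newton map, at most half as long, plus
the image of [F x - F x'] under the inverse of [A].  The bound gives injectivity
and makes the inverse Lipschitz. *)
Let F_expand x x' : V x -> V x' -> `|x - x'| <= 2 * C * `|F x - F x'|.
Proof.
move=> Vx Vx'; have H := newton_contract 0 Vx Vx'.
have E : x - x' = newton 0 x - newton 0 x' + (F x - F x') *m invmx A.
  rewrite /newton !sub0r opprD addrACA -[RHS]addrA -mulmxBl -mulmxDl.
  by rewrite opprK addrACA addNr subrr addr0 mul0mx addr0.
apply: absorb_half H (AVC (F x - F x')) _.
by rewrite {1}E; exact: ler_normD.
Qed.

Lemma local_injective x x' : V x -> V x' -> F x = F x' -> x = x'.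
Proof.
move=> Vx Vx' FE; apply/eqP; rewrite -subr_eq0 -normr_le0.
by rewrite (le_trans (F_expand Vx Vx'))// FE subrr normr0 mulr0.
Qed.

(** The Newton map contracts a closed ball into itself when [y] is close enough to
the image of the centre. *)
Lemma local_surjective x1 (s : R) y : 0 < s ->
  (forall x, `|x1 - x| <= s -> V x) -> `|y - F x1| <= s / (2 * C) ->
  exists2 x, V x & F x = y.
Proof.
move=> s0 sV ys; pose U := closed_ball_ (fun x => `|x|) x1 s.
have UV x : U x -> V x by exact: sV.
have Ux1 : U x1 by rewrite /U /closed_ball_/= subrr normr0 ltW.
have step x : U x -> U (newton y x).
  move=> Ux; rewrite /U /closed_ball_/=.
  have H1 : `|newton y x1 - newton y x| <= s / 2.
    rewrite (le_trans (newton_contract y (UV _ Ux1) (UV _ Ux)))// mulrC.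
    by rewrite ler_wpM2r.
  have H2 : `|newton y x1 - x1| <= s / 2.
    rewrite /newton addrC addKr (le_trans (AVC _))//.
    rewrite (le_trans (ler_wpM2l (ltW C0) ys))//.
    by rewrite invfM mulrCA [C * _]mulrC -mulrA mulVf ?gt_eqF// mulr1.
  rewrite (le_trans (ler_distD (newton y x1) _ _))// distrC.
  by rewrite (splitr s) lerD.
pose T : {fun U >-> U} := mkfun step.
have [|||x Ux] := @banach_fixed_point R 'rV[R]_m U T.
- have h0 : 0 <= (2^-1 : R) by [].
  exists (NngNum h0); split => /=; first by rewrite invf_lt1// ltr1n.
  by move=> [a b] [/= Ua Ub]; apply: newton_contract; exact: UV.
- exact: closed_closed_ball_.
- by exists x1.
move=> xE; exists x; first exact: UV.
have /(congr1 (mulmx^~ A)) : (y - F x) *m invmx A = 0.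
  by apply: (addrI x); rewrite addr0 [RHS]xE.
by rewrite mulmxKV// mul0mx => /eqP; rewrite subr_eq0 => /eqP.
Qed.

Lemma local_open : open V -> open (F @` V).
Proof.
move=> Vo; rewrite openE => _ [x1 Vx1 <-].
have [r /= r0 rV] := (nbhs_ballP _ _).1 (open_nbhs_nbhs (conj Vo Vx1)).
have r20 : 0 < r / 2 by rewrite divr_gt0.
apply/nbhs_ballP; exists (r / 2 / (2 * C)) => /=.
  by rewrite divr_gt0// mulr_gt0.
move=> y; rewrite -ball_normE /ball_/= distrC => yb.
have [|x Vx <-] := @local_surjective x1 (r / 2) y r20 _ (ltW yb); last by exists x.
move=> x xr; apply: rV; rewrite -ball_normE /ball_/= (le_lt_trans xr)//.
by rewrite ltr_pdivrMr// ltr_pMr// ltr1n.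
Qed.

Variable G : 'rV[R]_m -> 'rV[R]_m.
Hypothesis GF : forall x, V x -> G (F x) = x.
Hypothesis Vo : open V.
Hypothesis F1 : Ck_on 1 V F.
Hypothesis Fu : forall x, V x -> jac F x \in unitmx.

Let G_lip y y' : (F @` V) y -> (F @` V) y' -> `|G y - G y'| <= 2 * C * `|y - y'|.
Proof. by move=> [x Vx <-] [x' Vx' <-]; rewrite !GF//; exact: F_expand. Qed.

Let G_continuous y : (F @` V) y -> {for y, continuous G}.
Proof.
move=> Vy; apply: ((@cvgrPdist_le _ _ _ (nbhs y) _ G (G y)).2) => e e0.
have Vn : nbhs y (F @` V) by apply: open_nbhs_nbhs; split => //; exact: local_open.
have C20 : 0 < 2 * C by rewrite mulr_gt0.
have yn : \forall z \near y, `|y - z| < e / (2 * C).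
  have /cvgrPdist_lt := @cvg_id _ (nbhs y); apply; exact: divr_gt0.
apply: filterS2 Vn yn => z Vz yz; rewrite (le_trans (G_lip Vy Vz))//.
by rewrite mulrC -ler_pdivlMr// ltW.
Qed.

(** If [F x' = F x + h w], then [x' - x] is [h w] times the inverse Jacobian up
to an error that strict differentiability and the Lipschitz bound on [G] make
of order [o(h)]. *)
Let G_derive x w : V x -> is_derive (F x) w G (w *m invmx (jac F x)).
Proof.
move=> Vx; have Jx := Fu Vx; set v := w *m _.
suff cv : h^-1 *: ((G \o shift (F x)) (h *: w) - G (F x)) @[h --> 0^'] --> v.
  by split; [apply/cvg_ex; exists v|exact/cvg_lim].
have [B B0 BP] := mulmx_norm_bound (invmx (jac F x)).
apply/cvgrPdist_le => e e0.
pose K := B * (2 * C * (`|w| + 1)).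
have K0 : 0 < K by rewrite !mulr_gt0// ltr_wpDl.
have [r [r0 rV rP]] := strict_derivative Vo F1 Vx (divr_gt0 e0 K0).
have VFx : (F @` V) (F x) by exists x.
have ln : (h *: w + F x) @[h --> (0 : R)^'] --> F x.
  rewrite -[X in _ --> X]add0r -[X in _ --> X + _](scale0r w).
  apply: cvg_within_filter; apply: cvgD; last exact: cvg_cst.
  by apply: cvgZr_tmp; exact: cvg_id.
have Vn : \forall h \near (0 : R)^', (F @` V) (h *: w + F x).
  exact: ln _ (open_nbhs_nbhs (conj (local_open Vo) VFx)).
have Bn : \forall h \near (0 : R)^', ball x r (G (h *: w + F x)).
  have xb : nbhs (G (F x)) (ball x r) by rewrite GF//; exact: nbhsx_ballx.
  exact: ln _ (G_continuous VFx xb).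
near=> h.
have h0 : h != 0 by near: h; exact: nbhs_dnbhs_neq.
have Vh : (F @` V) (h *: w + F x).
  by near: h; exact: Vn.
have br : ball x r (G (h *: w + F x)).
  by near: h; exact: Bn.
have FG : F (G (h *: w + F x)) = h *: w + F x.
  by case: Vh => z Vz <-; rewrite GF.
have := rP _ _ br (ballxx x r0); rewrite FG addrK => H.
have lip := G_lip Vh VFx; rewrite addrK GF// normrZ in lip.
rewrite /= GF//; set x' := G _ in H lip *.
have -> : v - h^-1 *: (x' - x) =
    h^-1 *: ((h *: w - (x' - x) *m jac F x) *m invmx (jac F x)).
  by rewrite mulmxBl mulmxK// -scalemxAl [in RHS]scalerBr scalerA mulVf// scale1r.
rewrite normrZ normfV ler_pdivrMl ?normr_gt0//.
rewrite (le_trans (BP _))// (le_trans (ler_wpM2l (ltW B0) H))//.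
rewrite (le_trans (ler_wpM2l (ltW B0) (ler_wpM2l (ltW (divr_gt0 e0 K0)) lip)))//.
rewrite (_ : B * _ = `|h| * (e * ((B * (2 * C * `|w|)) / K))); last by ring.
rewrite ler_wpM2l// ler_piMr ?(ltW e0)// ler_pdivrMr// mul1r /K.
by rewrite !ler_pM2l ?mulr_gt0// lerDl.
Unshelve. all: by end_near. Qed.

(** Bootstrap: the derivative of [G] is the inverse Jacobian of [F] composed with
[G], so each step of the induction gains one derivative. *)
Lemma local_inverse_Ck k : Ck_on k.+1 V F -> Ck_on k.+1 (F @` V) G.
Proof.
have FVo : open (F @` V) := local_open Vo.
have GV y : (F @` V) y -> V (G y) by case=> x Vx <-; rewrite GF.
suff H j : Ck_on j V (fun x => invmx (jac F x)) -> Ck_on j (F @` V) G ->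
    Ck_on j.+1 (F @` V) G.
  move=> Fk; have invk := Ck_invmx Vo Fu (Ck_jac Vo Fk).
  apply: (H) => //; elim: k invk {Fk} => [|k IHk] invk.
    by split => // y; exact: G_continuous.
  by have invk' := CkW invk; apply: (H) => //; exact: IHk.
move=> invj Gj; apply: CkS => // w.
exists (fun y => w *m invmx (jac F (G y))).
  by move=> _ [x Vx <-]; rewrite GF//; exact: G_derive.
apply/Ck_mxP => // i j'.
apply: (@eq_Ck _ _ _ _ _ (fun y => \sum_l w i l * invmx (jac F (G y)) l j')) => //.
  by move=> y _; rewrite mxE.
apply: Ck_sum => // l; apply: CkM => //; first exact: Ck_cst.
exact: (Ck_comp FVo Vo GV ((Ck_mxP _ _ Vo).1 invj l j') Gj).
Qed.

End LocalInverse.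

(** Injectivity of the derivative is invertibility of the Jacobian, the domain and
the codomain having the same dimension.  Strict differentiability with constant
[(2 C)^-1], where [C] bounds the inverse Jacobian, makes the Newton map a
contraction with factor 1/2. *)
Theorem inverse_function {R : realType} m (D : set 'rV[R]_m)
    (F : 'rV[R]_m -> 'rV[R]_m) :
  open D -> smooth_on D F ->
  (forall x v, D x -> 'D_v F x = 0 -> v = 0) -> local_diffeo D F.
Proof.
move=> Do Fs Finj x0 Dx0.
have Fu x : D x -> jac F x \in unitmx.
  move=> Dx; rewrite -row_free_unit; apply: inj_row_free => v vJ.
  by apply: (Finj x) => //; rewrite (derive_jac _ Do (Fs 1%N)).
have [C C0 AVC] := mulmx_norm_bound (invmx (jac F x0)).
have C20 : 0 < (2 * C)^-1 by rewrite invr_gt0 mulr_gt0.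
have [r [r0 rD FA]] := strict_derivative Do (Fs 1%N) Dx0 C20.
pose V := ball x0 r; have Vo : open V by exact: ball_open.
pose G y := get [set x | V x /\ F x = y].
have GF x : V x -> G (F x) = x.
  move=> Vx; have [VG FG] : [set z | V z /\ F z = F x] (G (F x)).
    by apply: getPex; exists x.
  exact: (local_injective (Fu _ Dx0) C0 AVC FA).
exists V, G; split; [exact: ballxx|exact: rD|split=> //].
- exact: (local_open (Fu _ Dx0) C0 AVC FA).
- by move=> k; exact: sub_Ck rD (Fs k).
- move=> k; apply: CkW.
  apply: (local_inverse_Ck (Fu _ Dx0) C0 AVC FA GF Vo).
  + exact: sub_Ck rD (Fs 1%N).
  + by move=> x /rD; exact: Fu.
  + exact: sub_Ck rD (Fs _).
Qed.

(** * Integrals over the unit interval *)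

Section UnitInterval.
Context {R : realType}.
Implicit Types (f g : R -> R) (E V : normedModType R).

Definition int01 g : R := \int[lebesgue_measure]_(y in `[0, 1]) g y.

Lemma in01 (y : R) : `[0, 1]%classic y -> 0 <= y <= 1.
Proof. by rewrite /= in_itv. Qed.

Lemma integrable01 g : (forall y, 0 <= y <= 1 -> {for y, continuous g}) ->
  lebesgue_measure.-integrable `[0, 1] (EFin \o g).
Proof.
move=> gc; apply: continuous_compact_integrable; first exact: segment_compact.
apply: continuous_in_subspaceT => y; rewrite inE => /in01; exact: gc.
Qed.

Lemma eq_int01 f g : (forall y, 0 <= y <= 1 -> f y = g y) -> int01 f = int01 g.
Proof. by move=> fg; apply: eq_Rintegral => y; rewrite inE => /in01; exact: fg. Qed.

Lemma int01_cst (c : R) : int01 (fun=> c) = c.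
Proof.
by rewrite /int01 Rintegral_cst//= lebesgue_measure_itv/= lte01 oppr0 adde0 mulr1.
Qed.

Lemma int01D f g : (forall y, 0 <= y <= 1 -> {for y, continuous f}) ->
  (forall y, 0 <= y <= 1 -> {for y, continuous g}) ->
  int01 (fun y => f y + g y) = int01 f + int01 g.
Proof. by move=> fc gc; apply: RintegralD => //; exact: integrable01. Qed.

Lemma int01Z (c : R) g : (forall y, 0 <= y <= 1 -> {for y, continuous g}) ->
  int01 (fun y => c * g y) = c * int01 g.
Proof. by move=> gc; apply: RintegralZl => //; exact: integrable01. Qed.

Lemma int01_norm_le g (e : R) : (forall y, 0 <= y <= 1 -> {for y, continuous g}) ->
  (forall y, 0 <= y <= 1 -> `|g y| <= e) -> `|int01 g| <= e.
Proof.
move=> gc ge; have gi := integrable01 gc.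
rewrite (le_trans (le_normr_Rintegral _ gi))//.
rewrite -[leRHS]int01_cst; apply: le_Rintegral => //.
- apply: integrable01 => y y01; apply: continuous_comp; first exact: gc.
  exact: norm_continuous.
- by apply: (@integrable01 (cst e)) => y _; exact: cst_continuous.
Qed.

Lemma int01_derive (F f : R -> R) :
  (forall y, 0 <= y <= 1 -> {for y, continuous f}) ->
  (forall y : R, is_derive y 1 F (f y)) -> int01 f = F 1 - F 0.
Proof.
move=> fc Ff.
have Fc y : {for y, continuous F}.
  by apply/differentiable_continuous/derivable1_diffP; case: (Ff y).
rewrite /int01 /Rintegral (continuous_FTC2 (F := F))//.
- by apply: continuous_in_subspaceT => y; rewrite inE => /in01; exact: fc.
- split=> [y _||]; first by case: (Ff y).
  + by apply: cvg_at_right_filter; exact: Fc.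
  + by apply: cvg_at_left_filter; exact: Fc.
- by move=> y _; rewrite derive1E; case: (Ff y).
Qed.

Lemma int_rescale g (L : R) : 0 < L -> continuous g ->
  \int[lebesgue_measure]_(x in `[0, L]) g x = L * int01 (fun y => g (L * y)).
Proof.
move=> L0 gc; pose F (y : R) := L * y.
have dF (y : R) : is_derive y 1 F L.
  have := @is_deriveZ _ _ _ id L y 1 _ (is_derive_id _ _).
  by rewrite [_ *: 1]mulr1.
have Fc y : {for y, continuous F}.
  by apply/differentiable_continuous/derivable1_diffP; case: (dF y).
have F'E : derive1 F = cst L.
  by apply/funext => y; rewrite derive1E; case: (dF y).
have gFc y : {for y, continuous (fun y => g (L * y))}.
  by apply: (@continuous_comp _ _ _ F g); [exact: Fc|exact: gc].
rewrite -int01Z// /int01 /Rintegral; congr fine.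
rewrite -[X in `[X, L]](mulr0 L) -[X in `[_, X]](mulr1 L).
rewrite (@integration_by_substitution_increasing _ F g 0 1)//.
- by apply: eq_integral => y _; rewrite F'E /= mulrC.
- by move=> x y _ _ xy; rewrite /F ltr_pM2l.
- by move=> y _; rewrite F'E; exact: cst_continuous.
- by rewrite F'E; exact: is_cvg_cst.
- by rewrite F'E; exact: is_cvg_cst.
- split=> [y _||]; first by case: (dF y).
  + by apply: cvg_at_right_filter; exact: Fc.
  + by apply: cvg_at_left_filter; exact: Fc.
- exact: continuous_subspaceT.
Qed.

End UnitInterval.

Section Param.
Context {R : realType} {E : normedModType R}.
Implicit Types (D : set E) (h : E * R -> R).

Lemma continuous_pair (T : topologicalType) (V W : normedModType R)
  (f : T -> V) (g : T -> W) t :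
  {for t, continuous f} -> {for t, continuous g} ->
  {for t, continuous (fun s => (f s, g s))}.
Proof. by move=> fc gc; apply: cvg_pair. Qed.

Definition integral_param h (p : E) : R := int01 (fun y => h (p, y)).

Lemma continuous_slice D h p y : Ck_on 0 (D `*` setT) h -> D p ->
  {for y, continuous (fun y => h (p, y))}.
Proof.
move=> hc Dp; apply: (@continuous_comp _ _ _ (fun y => (p, y)) h).
  by apply: continuous_pair; [exact: cst_continuous|exact: cvg_id].
exact: continuous_Ck hc _.
Qed.

Lemma continuous_integral_param D h p : open D -> Ck_on 0 (D `*` setT) h ->
  D p -> {for p, continuous (integral_param h)}.
Proof.
move=> Do hc Dp; apply: ((@cvgrPdist_le _ _ _ (nbhs p) _ _ _).2) => e e0.
have Dn : nbhs p D := open_nbhs_nbhs (conj Do Dp).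
have e20 : 0 < e / 2 by rewrite divr_gt0.
(* uniformity in y comes from compactness of the unit interval *)
have : \forall q \near p, `[0, 1]%classic `<=` [set y : R | `|h (p, y) - h (q, y)| <= e].
  have /compact_near_coveringP := @segment_compact R 0 1; apply => y _.
  have hcy : {for (p, y), continuous h} by exact: continuous_Ck hc _.
  have Hpy := (cvgrPdist_lt _ _).1 hcy _ e20.
  have [[A B] /= [Ap By] AB] := Hpy.
  exists (B, A) => // -[y' q] /= [By' Aq].
  have H1 := AB (p, y') (conj (nbhs_singleton Ap) By').
  have H2 := AB (q, y') (conj Aq By').
  rewrite /= in H1 H2; rewrite (le_trans (ler_distD (h (p, y)) _ _))//.
  by rewrite (splitr e) (distrC _ (h (p, y))) lerD// ltW.
apply: filterS2 Dn => q Dq Hq.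
have cp := fun y (_ : 0 <= y <= 1) => continuous_slice (y := y) hc Dp.
have cq := fun y (_ : 0 <= y <= 1) => continuous_slice (y := y) hc Dq.
have cNq y : 0 <= y <= 1 -> {for y, continuous (fun y => -1 * h (q, y))}.
  by move=> y01; apply: continuousM; [exact: cst_continuous|exact: cq].
rewrite /integral_param -mulN1r -int01Z// -int01D//.
apply: int01_norm_le => [y y01|y y01].
  by apply: continuousD; [exact: cp|exact: cNq].
by rewrite mulN1r; exact: Hq.
Qed.

(** Differentiation under the integral sign; the domination is uniform because
the parameter moves in a segment and the variable in the unit interval. *)
Lemma is_derive_integral_param D h p v : open D -> Ck_on 1 (D `*` setT) h ->
  D p -> is_derive p v (integral_param h) (integral_param ('D_(v, 0) h) p).
Proof.
move=> Do h1 Dp.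
have hc := CkW h1; have dc := Ck_derive (v, 0) h1.
have Dn : nbhs p D := open_nbhs_nbhs (conj Do Dp).
have lc (t : R) : {for t, continuous (fun t : R => t *: v + p)}.
  apply: continuousD; last exact: cst_continuous.
  by apply: cvgZr_tmp; exact: cvg_id.
have [d d0 dD] : exists2 d : R, 0 < d & forall t : R, `|t| <= d -> D (t *: v + p).
  have : \forall t \near (0 : R), D (t *: v + p).
    by apply: (lc 0); rewrite scale0r add0r.
  move=> /nbhs_ballP[r /= r0 rD]; exists (r / 2); first by rewrite divr_gt0.
  move=> t td; apply: rD; rewrite -ball_normE /ball_/= sub0r normrN.
  by rewrite (le_lt_trans td)// ltr_pdivrMr// ltr_pMr// ltr1n.
have itvd (t : R) : t \in `]-d, d[ -> `|t| <= d.
  by rewrite in_itv/= => /andP[t1 t2]; rewrite ler_norml !ltW.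
pose phi t y := h (t *: v + p, y).
have dphi (t y : R) : `|t| <= d ->
    is_derive t 1 (phi ^~ y) ('D_(v, 0) h (t *: v + p, y)).
  move=> td.
  have phiE : phi ^~ y = (fun s : R => h (s *: ((v, 0) : E * R) + (p, y))).
    apply/funext => s; rewrite /phi; congr (h (_, _)).
    by rewrite /= [s *: 0]mulr0 add0r.
  rewrite phiE; apply: is_derive_line.
  have -> : t *: ((v, 0) : E * R) + (p, y) = (t *: v + p, y).
    by congr (_, _); rewrite /= [t *: 0]mulr0 add0r.
  by apply: is_derive_Ck h1 _; split => //=; exact: dD.
have [M M0 MP] : exists2 M : R, 0 < M & forall t y : R, `|t| <= d -> 0 <= y <= 1 ->
    `|'D_(v, 0) h (t *: v + p, y)| <= M.
  pose psi (ty : R * R) := 'D_(v, 0) h (ty.1 *: v + p, ty.2).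
  pose K := `[-d, d]%classic `*` `[0, 1]%classic : set (R * R).
  have Kc : compact K by apply: compact_setX; exact: segment_compact.
  have psic : {within K, continuous psi}.
    apply: continuous_in_subspaceT => -[t y]; rewrite inE => -[/= td _].
    have td' : `|t| <= d by move: td; rewrite in_itv/= ler_norml.
    apply: (@continuous_comp _ _ _ (fun ty : R * R => (ty.1 *: v + p, ty.2)) ('D_(v, 0) h)).
      apply: continuous_pair; last exact: cvg_snd.
      apply: (@continuous_comp _ _ _ fst (fun t : R => t *: v + p)); last exact: lc.
      exact: cvg_fst.
    by apply: continuous_Ck dc _; split => //=; exact: dD.
  have /ex_strict_bound_gt0[M M0 MP] : bounded_set (psi @` K).
    exact/compact_bounded/continuous_compact.
  exists M => // t y td y01; apply/ltW/MP; exists (t, y) => //; split => /=.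
    by rewrite in_itv/= -ler_norml.
  by rewrite in_itv.
have Ia : `]-d, d[%classic (0 : R) by rewrite /= in_itv/= oppr_lt0 d0.
have mB : @measurable _ (measurableTypeR R) `[0, 1]%classic by exact: measurable_itv.
have phic (t y : R) : `|t| <= d -> {for y, continuous (phi t)}.
  by move=> td; apply: continuous_slice hc _; exact: dD.
have intf (t : R) : `]-d, d[%classic t ->
    lebesgue_measure.-integrable `[0, 1] (EFin \o phi t).
  by move=> td; apply: integrable01 => y _; apply: phic; exact: itvd.
have derf (t y : R) : `]-d, d[%classic t -> `[0, 1]%classic y ->
    derivable (phi ^~ y) t 1.
  by move=> td _; case: (dphi t y (itvd _ td)).
have intM : lebesgue_measure.-integrable `[0, 1] (EFin \o cst M).
  by apply: (@integrable01 _ (cst M)) => y _; exact: cst_continuous.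
have ubM (t y : R) : `]-d, d[%classic t -> `[0, 1]%classic y ->
    `|partial1of2 phi t y| <= cst M y.
  move=> td /in01 y01; rewrite partial1of2E.
  by case: (dphi t y (itvd _ td)) => _ ->; exact: MP (itvd _ td) y01.
have M0' (y : R) : 0 <= cst M y by exact: ltW.
apply: is_derive_from_line; split.
  exact: (derivable_under_integral mB Ia intf derf M0' intM ubM).
rewrite -derive1E (differentiation_under_integral mB Ia intf derf M0' intM ubM).
apply: eq_int01 => y y01; rewrite partial1of2E.
have d00 : `|0 : R| <= d by rewrite normr0 ltW.
by case: (dphi 0 y d00) => _ ->; rewrite scale0r add0r.
Qed.

Lemma Ck_integral_param k D h : open D ->
  Ck_on k (D `*` setT) h -> Ck_on k D (integral_param h).
Proof.
move=> Do; elim: k h => [|k IHk] h hk.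
  by split=> // p; exact: continuous_integral_param Do hk.
have h1 : Ck_on 1 (D `*` setT) h by elim: k hk {IHk} => // k IHk /CkW.
apply: CkS => // [p|v].
  by apply: continuous_integral_param (Do) _; exact: CkW h1.
exists (integral_param ('D_(v, 0) h)); last exact/IHk/Ck_derive.
by move=> p; exact: is_derive_integral_param Do h1.
Qed.

End Param.

(** * Calculus of maps of a vector and a real variable *)

Section Pairs.
Context {R : realType}.
Implicit Types (E V : normedModType R).

Lemma openXT (T1 T2 : topologicalType) (D : set T1) :
  open D -> open (D `*` [set: T2]).
Proof.
move=> Do; have -> : D `*` [set: T2] = fst @^-1` D.
  by apply/seteqP; split=> [[x y] []|[x y]].
by apply: open_comp => // -[x y] _; exact: cvg_fst.
Qed.

Lemma is_derive_slice1 E (V : normedModType R) (g : E * R -> V) (p : E) (y : R) (v : E) dg :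
  is_derive (p, y) ((v, 0) : E * R) g dg -> is_derive p v (fun q => g (q, y)) dg.
Proof.
move=> gd; apply: is_derive_from_line.
have -> : (fun t : R => g (t *: v + p, y)) =
          (fun t : R => g (t *: ((v, 0) : E * R) + (p, y))).
  by apply/funext => t; congr (g (_, _)); rewrite /= [t *: 0]mulr0 add0r.
apply: is_derive_line; rewrite (_ : _ + _ = (p, y))//.
by congr (_, _); rewrite /= scale0r add0r.
Qed.

Lemma is_derive_slice2 E (V : normedModType R) (g : E * R -> V) (p : E) (y : R) dg :
  is_derive (p, y) ((0, 1) : E * R) g dg -> is_derive y 1 (fun s => g (p, s)) dg.
Proof.
move=> gd.
have -> : (fun s : R => g (p, s)) =
          (fun s : R => g (s *: ((0, 1) : E * R) + (p, 0))).
  apply/funext => s; congr (g (_, _)); first by rewrite /= scaler0 add0r.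
  by rewrite /= [s *: 1]mulr1 addr0.
apply: is_derive_line; rewrite (_ : _ + _ = (p, y))//.
by congr (_, _); rewrite /= ?scaler0 ?add0r// [y *: 1]mulr1 addr0.
Qed.

(** Transports maps on pairs to maps on row vectors, for which the chain rule is
stated. *)
Definition rV_pair m (w : 'rV[R]_(m + 1)) : 'rV[R]_m * R := (lsubmx w, rsubmx w 0 0).

Lemma rV_pair_is_linear m : linear (@rV_pair m).
Proof.
move=> a u v; rewrite /rV_pair.
have -> : lsubmx (a *: u + v) = a *: lsubmx u + lsubmx v by rewrite linearP.
by have -> : rsubmx (a *: u + v) 0 0 = a * rsubmx u 0 0 + rsubmx v 0 0 by rewrite !mxE.
Qed.

HB.instance Definition _ m :=
  GRing.isLinear.Build R 'rV[R]_(m + 1) ('rV[R]_m * R)%type _ (@rV_pair m)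
    (@rV_pair_is_linear m).

Lemma continuous_rV_pair m : continuous (@rV_pair m).
Proof.
move=> w; apply: continuous_pair.
  by apply: differentiable_continuous; exact: differentiable_lsubmx.
have -> : (fun w : 'rV[R]_(m + 1) => rsubmx w 0 0) = (fun w => w 0 (rshift m 0)).
  by apply/funext => v; rewrite mxE.
exact: coord_continuous.
Qed.

Lemma Ck_rowP E k (D : set E) m (g : E -> 'rV[R]_m) : open D ->
  Ck_on k D g <-> forall i, Ck_on k D (fun x => g x 0 i).
Proof.
move=> Do; split=> [/(Ck_mxP _ _ Do) gk i|gk]; first exact: gk.
by apply/(Ck_mxP _ _ Do) => i j; rewrite ord1; exact: gk.
Qed.

Lemma Ck_row_mx E k (D : set E) m p (a : E -> 'rV[R]_m) (b : E -> 'rV[R]_p) :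
  open D -> Ck_on k D a -> Ck_on k D b -> Ck_on k D (fun x => row_mx (a x) (b x)).
Proof.
move=> Do /(Ck_rowP _ _ Do) ak /(Ck_rowP _ _ Do) bk; apply/(Ck_rowP _ _ Do) => i.
case: (split_ordP i) => j ->.
  by apply: eq_Ck (ak j) => // x _; rewrite row_mxEl.
by apply: eq_Ck (bk j) => // x _; rewrite row_mxEr.
Qed.

Lemma Ck_comp_pair E m k (D : set E) (D' : set ('rV[R]_m * R))
    (g : 'rV[R]_m * R -> R) (a : E -> 'rV[R]_m) (b : E -> R) :
  open D -> open D' -> (forall x, D x -> D' (a x, b x)) ->
  Ck_on k D' g -> Ck_on k D a -> Ck_on k D b -> Ck_on k D (fun x => g (a x, b x)).
Proof.
move=> Do D'o DD' gk ak bk.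
pose ab x := row_mx (a x) (b x)%:M : 'rV[R]_(m + 1).
have abE x : rV_pair (ab x) = (a x, b x).
  by congr (_, _); rewrite ?row_mxKl// row_mxKr mxE mulr1n.
have gk' := Ck_comp_linear (@continuous_rV_pair m) D'o gk.
have D''o : open (@rV_pair m @^-1` D').
  by apply: open_comp => // w _; exact: continuous_rV_pair.
apply: eq_Ck (Do) _ (Ck_comp Do D''o _ gk' _).
- by move=> x _; rewrite -abE.
- by move=> x /DD'; rewrite -abE.
- apply: Ck_row_mx => //; apply/(Ck_rowP _ _ Do) => i.
  by apply: eq_Ck bk => // x _; rewrite ord1 mxE mulr1n.
Qed.

Lemma Ck_comp_pair_row E m p k (D : set E) (D' : set ('rV[R]_m * R))
    (g : 'rV[R]_m * R -> 'rV[R]_p) (a : E -> 'rV[R]_m) (b : E -> R) :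
  open D -> open D' -> (forall x, D x -> D' (a x, b x)) ->
  Ck_on k D' g -> Ck_on k D a -> Ck_on k D b -> Ck_on k D (fun x => g (a x, b x)).
Proof.
move=> Do D'o DD' /(Ck_rowP _ _ D'o) gk ak bk; apply/(Ck_rowP _ _ Do) => i.
exact: Ck_comp_pair DD' (gk i) ak bk.
Qed.

Lemma Ck_dotp E k (D : set E) m (a b : E -> 'rV[R]_m) : open D ->
  Ck_on k D a -> Ck_on k D b -> Ck_on k D (fun x => dotp (a x) (b x)).
Proof.
move=> Do /(Ck_rowP _ _ Do) ak /(Ck_rowP _ _ Do) bk.
by apply: Ck_sum => // i; exact: CkM.
Qed.

Lemma derivable_coord E m (a : E -> 'rV[R]_m) x v i :
  derivable a x v -> derivable (fun y => a y 0 i) x v.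
Proof. by move=> /derivable_mxP; exact. Qed.

Lemma derive_coord E m (a : E -> 'rV[R]_m) x v i :
  derivable a x v -> 'D_v (fun y => a y 0 i) x = 'D_v a x 0 i.
Proof. by move=> ad; rewrite derive_mx// mxE. Qed.

Lemma is_derive_rowP E m (a : E -> 'rV[R]_m) x v (da : 'rV[R]_m) :
  (forall i, is_derive x v (fun y => a y 0 i) (da 0 i)) -> is_derive x v a da.
Proof.
move=> ad; have dv : derivable a x v.
  by apply/derivable_mxP => i j; rewrite ord1; case: (ad j).
split=> //; apply/rowP => i; rewrite -derive_coord//; by case: (ad i).
Qed.

Lemma is_derive_dotp E m (a b : E -> 'rV[R]_m) x v da db :
  is_derive x v a da -> is_derive x v b db ->
  is_derive x v (fun y => dotp (a y) (b y)) (dotp da (b x) + dotp (a x) db).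
Proof.
move=> [ad <-] [bd <-].
have H : is_derive x v (\sum_i (fun y => a y 0 i * b y 0 i))
    (\sum_i (a x 0 i *: 'D_v b x 0 i + b x 0 i *: 'D_v a x 0 i)).
  apply: is_derive_sum => i; rewrite -!derive_coord//.
  by apply: is_deriveM; apply: derivableP; exact: derivable_coord.
have -> : (fun y => dotp (a y) (b y)) = \sum_i (fun y => a y 0 i * b y 0 i).
  by apply/funext => y; rewrite fct_sumE.
apply: is_derive_eq H _; rewrite /dotp -big_split/=; apply: eq_bigr => i _.
by rewrite addrC; congr (_ + _); exact: mulrC.
Qed.

Lemma derive_row_mx E m p (a : E -> 'rV[R]_m) (b : E -> 'rV[R]_p) x v da db :
  is_derive x v a da -> is_derive x v b db ->
  is_derive x v (fun y => row_mx (a y) (b y)) (row_mx da db).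
Proof.
move=> [ad <-] [bd <-]; apply: is_derive_rowP => i; case: (split_ordP i) => j ->.
  have -> : (fun y => row_mx (a y) (b y) 0 (lshift p j)) = (fun y => a y 0 j).
    by apply/funext => y; rewrite row_mxEl.
  by rewrite row_mxEl -derive_coord//; apply: derivableP; exact: derivable_coord.
have -> : (fun y => row_mx (a y) (b y) 0 (rshift m j)) = (fun y => b y 0 j).
  by apply/funext => y; rewrite row_mxEr.
by rewrite row_mxEr -derive_coord//; apply: derivableP; exact: derivable_coord.
Qed.

Lemma dotp_row_mx m p (a a' : 'rV[R]_m) (b b' : 'rV[R]_p) :
  dotp (row_mx a b) (row_mx a' b') = dotp a a' + dotp b b'.
Proof.
rewrite /dotp big_split_ord/=; congr (_ + _); apply: eq_bigr => i _.
  by rewrite !row_mxEl.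
by rewrite !row_mxEr.
Qed.

Lemma dotpC m (a b : 'rV[R]_m) : dotp a b = dotp b a.
Proof. by apply: eq_bigr => i _; rewrite mulrC. Qed.

Lemma dotpDl m (a b c : 'rV[R]_m) : dotp (a + b) c = dotp a c + dotp b c.
Proof. by rewrite /dotp -big_split; apply: eq_bigr => i _; rewrite mxE mulrDl. Qed.

Lemma dotpDr m (a b c : 'rV[R]_m) : dotp a (b + c) = dotp a b + dotp a c.
Proof. by rewrite dotpC dotpDl !(dotpC a). Qed.

Lemma dotpZl m (x : R) (a b : 'rV[R]_m) : dotp (x *: a) b = x * dotp a b.
Proof. by rewrite /dotp mulr_sumr; apply: eq_bigr => i _; rewrite mxE mulrA. Qed.

Lemma dotpZr m (x : R) (a b : 'rV[R]_m) : dotp a (x *: b) = x * dotp a b.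
Proof. by rewrite dotpC dotpZl dotpC. Qed.

Lemma dotpNl m (a b : 'rV[R]_m) : dotp (- a) b = - dotp a b.
Proof. by rewrite -scaleN1r dotpZl mulN1r. Qed.

Lemma dotpNr m (a b : 'rV[R]_m) : dotp a (- b) = - dotp a b.
Proof. by rewrite dotpC dotpNl dotpC. Qed.

Lemma dotp_mxact m (A : 'M[R]_m) (a b : 'rV[R]_m) :
  dotp a (mxact A b) = dotp (mxact A^T a) b.
Proof.
rewrite /dotp /mxact trmxK.
under eq_bigr do rewrite mxE mulr_sumr.
rewrite exchange_big/=; apply: eq_bigr => j _; rewrite mxE mulr_suml.
by apply: eq_bigr => i _; rewrite !mxE mulrCA mulrC.
Qed.

End Pairs.

(** * Energy densities *)

Section Density.
Context {R : realType} {N : nat}.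
Implicit Types (E : normedModType R).
Variables (S : set 'rV[R]_N) (Ham : 'rV[R]_N -> 'rV[R]_N -> R).
Let joint (w : 'rV[R]_(N + N)) := Ham (lsubmx w) (rsubmx w).
Let SS : set 'rV[R]_(N + N) := [set w | S (lsubmx w)].
Hypothesis So : open S.
Hypothesis Hams : smooth_on SS joint.

Definition gradU (a b : 'rV[R]_N) : 'rV[R]_N := grad (fun w => Ham w b) a.
Definition gradUx (a b : 'rV[R]_N) : 'rV[R]_N := grad (Ham a) b.

Let SSo : open SS.
Proof.
apply: open_comp => // w _; apply: differentiable_continuous.
exact: differentiable_lsubmx.
Qed.

(** A density is differentiated as a function of the single vector (U, U_x); its
gradient there consists of the two partial gradients. *)
Let grad_joint a b : grad joint (row_mx a b) = row_mx (gradU a b) (gradUx a b).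
Proof.
have addl (h : R) (i : 'I_N) : h *: delta_mx 0 (lshift N i) + row_mx a b =
    row_mx (h *: delta_mx 0 i + a) b.
  rewrite -[delta_mx _ _](_ : row_mx (delta_mx 0 i) 0 = _).
    by rewrite scale_row_mx add_row_mx scaler0 add0r.
  apply/rowP => j; case: (split_ordP j) => j' ->; rewrite ?row_mxEl ?row_mxEr !mxE eqxx//=.
  by rewrite eq_rlshift.
have addr (h : R) (i : 'I_N) : h *: delta_mx 0 (rshift N i) + row_mx a b =
    row_mx a (h *: delta_mx 0 i + b).
  rewrite -[delta_mx _ _](_ : row_mx 0 (delta_mx 0 i) = _).
    by rewrite scale_row_mx add_row_mx scaler0 add0r.
  apply/rowP => j; case: (split_ordP j) => j' ->; rewrite ?row_mxEl ?row_mxEr !mxE eqxx//=.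
    by rewrite eq_lrshift.
  by rewrite eq_rshift.
apply/rowP => j; case: (split_ordP j) => i ->; rewrite ?row_mxEl ?row_mxEr !mxE.
  rewrite /derive; set q1 := fun h : R => _; set q2 := fun h : R => _.
  suff -> : q1 = q2 by [].
  by apply/funext => h; rewrite /q1 /q2 /= addl /joint !row_mxKl !row_mxKr.
rewrite /derive; set q1 := fun h : R => _; set q2 := fun h : R => _.
suff -> : q1 = q2 by [].
by apply/funext => h; rewrite /q1 /q2 /= addr /joint !row_mxKl !row_mxKr.
Qed.

Let jointE a b : joint (row_mx a b) = Ham a b.
Proof. by rewrite /joint row_mxKl row_mxKr. Qed.

Lemma Ck_Ham E k (D : set E) (a b : E -> 'rV[R]_N) : open D ->
  (forall x, D x -> S (a x)) -> Ck_on k D a -> Ck_on k D b ->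
  Ck_on k D (fun x => Ham (a x) (b x)).
Proof.
move=> Do DS ak bk.
apply: eq_Ck (Do) _ (Ck_comp Do SSo _ (Hams k) (Ck_row_mx Do ak bk)).
  by move=> x _; rewrite /= jointE.
by move=> x Dx; rewrite /SS/= row_mxKl; exact: DS.
Qed.

Lemma Ck_gradUx E k (D : set E) (a b : E -> 'rV[R]_N) : open D ->
  (forall x, D x -> S (a x)) -> Ck_on k D a -> Ck_on k D b ->
  Ck_on k D (fun x => gradUx (a x) (b x)).
Proof.
move=> Do DS ak bk; apply/(Ck_rowP _ _ Do) => i.
have gk := Ck_derive (delta_mx 0 (rshift N i)) (Hams k.+1).
apply: eq_Ck (Do) _ (Ck_comp Do SSo _ gk (Ck_row_mx Do ak bk)).
  move=> x _; have := grad_joint (a x) (b x).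
  by move=> /(congr1 (fun w : 'rV[R]_(N + N) => w 0 (rshift N i))); rewrite mxE row_mxEr.
by move=> x Dx; rewrite /SS/= row_mxKl; exact: DS.
Qed.

Lemma is_derive_Ham E (a b : E -> 'rV[R]_N) x v da db : S (a x) ->
  is_derive x v a da -> is_derive x v b db ->
  is_derive x v (fun y => Ham (a y) (b y))
    (dotp da (gradU (a x) (b x)) + dotp db (gradUx (a x) (b x))).
Proof.
move=> Sax ad bd; have [abd abE] := derive_row_mx ad bd.
have -> : (fun y => Ham (a y) (b y)) = joint \o (fun y => row_mx (a y) (b y)).
  by apply/funext => y; rewrite /= jointE.
apply: is_derive_eq.
  by apply: chain_rule SSo (Hams 1%N) _ abd; rewrite /SS/= row_mxKl.
by rewrite abE grad_joint dotp_row_mx.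
Qed.

Lemma derivable_Ham_U a b v : S a -> derivable (fun w => Ham w b) a v.
Proof.
move=> Sa; have [] // := @is_derive_Ham _ id (cst b) a v v 0 Sa (is_derive_id _ _) _.
Qed.

End Density.

(** * Rescaling to period one *)

Section Rescale.
Context {R : realType} {m : nat}.
Local Notation par := ('rV[R]_m).
Variables (Omega : set par) (Xi : par -> R).
Hypothesis Oo : open Omega.
Hypothesis Xis : smooth_on Omega Xi.
Let O := Omega `*` [set: R].
Let OO : open O := openXT Oo.

Lemma Ck_fst (E : normedModType R) k (f : par -> E) :
  Ck_on k Omega f -> Ck_on k O (fun q => f q.1).
Proof.
move=> fk; have fstc : continuous (fst : par * R -> par) by move=> x; exact: cvg_fst.
have := @Ck_comp_linear _ (par * R)%type par E k Omega fst f fstc Oo fk.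
by apply: sub_Ck => q [].
Qed.

Lemma Ck_snd k (D : set (par * R)) : open D -> Ck_on k D snd.
Proof. by move=> Do; apply: Ck_linear => // x; exact: cvg_snd. Qed.

Definition rescale (T : Type) (g : par * R -> T) (q : par * R) : T :=
  g (q.1, Xi q.1 * q.2).

Lemma Ck_rescale p k (g : par * R -> 'rV[R]_p) :
  Ck_on k O g -> Ck_on k O (rescale g).
Proof.
move=> gk; apply: Ck_comp_pair_row (OO) (OO) _ gk _ _.
- by move=> q [].
- by apply: (@Ck_linear _ _ _ k O fst) => // x; exact: cvg_fst.
- by apply: CkM => //; [exact: Ck_fst|exact: Ck_snd].
Qed.

Lemma derive_rescale p (g : par * R -> 'rV[R]_p) q : Ck_on 1 O g -> O q ->
  'D_((0, 1) : par * R) (rescale g) q =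
  Xi q.1 *: rescale ('D_((0, 1) : par * R) g) q.
Proof.
move: q => [w y] g1 [/= Ow _]; set d2 := ((0, 1) : par * R).
have [_ <-] := is_derive_slice2 (is_derive_Ck d2 (Ck_rescale g1) (conj Ow I : O (w, y))).
pose F s := g (w, s); set L := Xi w.
have [Fd FE] := is_derive_slice2 (is_derive_Ck d2 g1 (conj Ow I : O (w, L * y))).
have Fdiff : differentiable F (L * y) by exact/derivable1_diffP.
have FL : is_derive (L *: y) (L *: (1 : R)) F (L *: 'D_d2 g (w, L * y)).
  split; first exact: diff_derivable.
  have -> : 'D_(L *: (1 : R)) F (L *: y) = 'd F (L *: y) (L *: (1 : R)).
    exact: deriveE Fdiff.
  have -> : 'd F (L *: y) (L *: (1 : R)) = L *: 'd F (L *: y) (1 : R).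
    exact: linearZ.
  by rewrite -FE; congr (L *: _); exact/esym/(deriveE _ Fdiff).
have [_] := @is_derive_comp_linear R R R _ (GRing.scale L) F y 1 _ FL.
by [].
Qed.

End Rescale.

(** * Quadratic forms, parameters and triples *)

Section Preliminaries.
Context {R : realType}.
Implicit Types (E : normedModType R).

Lemma ordP2 (i : 'I_2) : i = 0 \/ i = 1.
Proof. by case: i => [[|[|//]] ?]; [left|right]; apply/val_inj. Qed.

Lemma dotp0l m (a : 'rV[R]_m) : dotp 0 a = 0.
Proof. by rewrite /dotp big1// => i _; rewrite mxE mul0r. Qed.

Lemma dotp0r m (a : 'rV[R]_m) : dotp a 0 = 0.
Proof. by rewrite dotpC dotp0l. Qed.

Lemma dotp_delta m (a : 'rV[R]_m) i : dotp a (delta_mx 0 i) = a 0 i.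
Proof.
rewrite /dotp (bigD1 i)//= mxE !eqxx mulr1 big1 ?addr0// => j ji.
by rewrite mxE eqxx (negbTE ji) mulr0.
Qed.

Lemma half_double (d : R) : 2^-1 * (d + d) = d.
Proof. lra. Qed.

Lemma int01_sum (J : Type) (r : seq J) (g : J -> R -> R) :
  (forall j y, {for y, continuous (g j)}) ->
  int01 (fun y => \sum_(j <- r) g j y) = \sum_(j <- r) int01 (g j).
Proof.
move=> gc; have sc r' y : {for y, continuous (fun y => \sum_(j <- r') g j y)}.
  have g0 j : Ck_on 0 [set: R] (g j) by split=> // z _; exact: gc.
  exact: (continuous_Ck (Ck_sum r' predT openT g0)).
elim: r => [|j r IHr].
  by under eq_fun do rewrite big_nil; rewrite big_nil int01_cst.
under eq_fun do rewrite big_cons.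
by rewrite big_cons -IHr -int01D.
Qed.

Lemma int01_dotp m (a : R -> 'rV[R]_m) (w : 'rV[R]_m) :
  (forall i y, {for y, continuous (fun y => a y 0 i)}) ->
  int01 (fun y => dotp (a y) w) = dotp (\row_i int01 (fun y => a y 0 i)) w.
Proof.
move=> ac; rewrite /dotp (int01_sum _ (g := fun i y => a y 0 i * w 0 i)).
  apply: eq_bigr => i _; rewrite mxE mulrC -int01Z//.
  by apply: eq_int01 => y _; rewrite mulrC.
by move=> i y; apply: continuousM; [exact: ac|exact: cst_continuous].
Qed.

Lemma is_derive_coord E m (a : E -> 'rV[R]_m) x v da i :
  is_derive x v a da -> is_derive x v (fun y => a y 0 i) (da 0 i).
Proof.
move=> [ad <-]; rewrite -derive_coord//; apply: derivableP; exact: derivable_coord.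
Qed.

Lemma mxactE m (A : 'M[R]_m) (x : 'rV[R]_m) i : mxact A x 0 i = dotp x (row i A).
Proof. by rewrite /mxact mxE; apply: eq_bigr => j _; rewrite !mxE. Qed.

Lemma is_derive_scalev E m (a : E -> R) (b : E -> 'rV[R]_m) x v da db :
  is_derive x v a da -> is_derive x v b db ->
  is_derive x v (fun y => a y *: b y) (da *: b x + a x *: db).
Proof.
move=> ad bd; apply: is_derive_rowP => i.
have -> : (fun y => (a y *: b y) 0 i) = a * (fun y => b y 0 i).
  by apply/funext => y; rewrite mxE.
apply: is_derive_eq (is_deriveM ad (is_derive_coord i bd)) _.
by rewrite !mxE addrC; congr (_ + _); exact: mulrC.
Qed.

Lemma is_derive_mxact E m (A : 'M[R]_m) (a : E -> 'rV[R]_m) x v da :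
  is_derive x v a da -> is_derive x v (fun y => mxact A (a y)) (mxact A da).
Proof.
move=> ad; apply: is_derive_rowP => i.
have -> : (fun y => mxact A (a y) 0 i) = (fun y => dotp (a y) (row i A)).
  by apply/funext => y; rewrite mxactE.
apply: is_derive_eq (is_derive_dotp ad (is_derive_cst _ _ _)) _.
by rewrite mxactE /dotp [X in _ + X]big1 ?addr0// => j _; rewrite mxE mulr0.
Qed.

Lemma Ck_mxact E k (D : set E) m (A : 'M[R]_m) (a : E -> 'rV[R]_m) : open D ->
  Ck_on k D a -> Ck_on k D (fun x => mxact A (a x)).
Proof.
move=> Do ak; apply/(Ck_rowP _ _ Do) => i.
apply: eq_Ck (Do) _ (Ck_dotp Do ak (Ck_cst k (row i A) Do)) => x _.
by rewrite mxactE.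
Qed.

(** The two functions have the same difference quotients. *)
Lemma grad_addcst m (g : 'rV[R]_m -> R) (c : R) x :
  grad (fun w => g w + c) x = grad g x.
Proof.
apply/rowP => i; rewrite !mxE /derive; set q1 := fun h : R => _; set q2 := fun h : R => _.
suff -> : q1 = q2 by [].
by apply/funext => h; rewrite /q1 /q2 /= opprD addrACA subrr addr0.
Qed.

Section SymmetricForm.
Variables (n : nat) (B : 'M[R]_n.+1).
Hypothesis Bu : B \in unitmx.
Hypothesis Bsym : B^T = B.

Lemma dotp_mxact_sym (a b : 'rV[R]_n.+1) :
  dotp a (mxact (invmx B) b) = dotp b (mxact (invmx B) a).
Proof. by rewrite dotp_mxact trmx_inv Bsym dotpC. Qed.

Lemma mxactK (a : 'rV[R]_n.+1) : mxact B (mxact (invmx B) a) = a.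
Proof. by rewrite /mxact trmx_inv Bsym mulmxKV. Qed.

Lemma is_derive_Qf E (a : E -> 'rV[R]_n.+1) x v da : is_derive x v a da ->
  is_derive x v (fun y => Qf B (a y)) (dotp da (mxact (invmx B) (a x))).
Proof.
move=> ad; have H := is_derive_dotp ad (is_derive_mxact (invmx B) ad).
apply: is_derive_eq (is_deriveZ 2^-1 H) _.
by rewrite (dotp_mxact_sym (a x)); exact: half_double.
Qed.

Lemma Ck_Qf E k (D : set E) (a : E -> 'rV[R]_n.+1) : open D ->
  Ck_on k D a -> Ck_on k D (fun x => Qf B (a x)).
Proof.
move=> Do ak; apply: (CkM Do (Ck_cst k (2^-1 : R) Do)).
by apply: Ck_dotp => //; exact: Ck_mxact.
Qed.

End SymmetricForm.

Section ParamCoordinates.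
Variable n : nat.
Local Notation par := ('rV[R]_(2 + n.+1)).

Lemma muE (p : par) : mu p = p 0 (lshift n.+1 0).
Proof. by rewrite /mu mxE. Qed.

Lemma ccE (p : par) : cc p = p 0 (lshift n.+1 1).
Proof. by rewrite /cc mxE. Qed.

Lemma lamE (p : par) i : lam p 0 i = p 0 (rshift 2 i).
Proof. by rewrite /lam mxE. Qed.

Lemma is_derive_mu E (a : E -> par) x v da :
  is_derive x v a da -> is_derive x v (fun y => mu (a y)) (mu da).
Proof. by move=> ad; under eq_fun do rewrite muE; rewrite muE; exact: is_derive_coord. Qed.

Lemma is_derive_cc E (a : E -> par) x v da :
  is_derive x v a da -> is_derive x v (fun y => cc (a y)) (cc da).
Proof. by move=> ad; under eq_fun do rewrite ccE; rewrite ccE; exact: is_derive_coord. Qed.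

Lemma is_derive_lam E (a : E -> par) x v da :
  is_derive x v a da -> is_derive x v (fun y => lam (a y)) (lam da).
Proof.
move=> ad; apply: is_derive_rowP => i.
by under eq_fun do rewrite lamE; rewrite lamE; exact: is_derive_coord.
Qed.

Lemma Ck_mu E k (D : set E) (a : E -> par) : open D ->
  Ck_on k D a -> Ck_on k D (fun y => mu (a y)).
Proof.
by move=> Do ak; under eq_fun do rewrite muE; exact: ((Ck_rowP _ _ Do).1 ak).
Qed.

Lemma Ck_cc E k (D : set E) (a : E -> par) : open D ->
  Ck_on k D a -> Ck_on k D (fun y => cc (a y)).
Proof.
by move=> Do ak; under eq_fun do rewrite ccE; exact: ((Ck_rowP _ _ Do).1 ak).
Qed.

Lemma Ck_lam E k (D : set E) (a : E -> par) : open D ->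
  Ck_on k D a -> Ck_on k D (fun y => lam (a y)).
Proof.
move=> Do ak; apply/(Ck_rowP _ _ Do) => i.
by under eq_fun do rewrite lamE; exact: ((Ck_rowP _ _ Do).1 ak).
Qed.

End ParamCoordinates.

Section Triple.
Variable n : nat.
Local Notation vec := ('rV[R]_n.+1).

Lemma triple_lshift (x y : R) (w : vec) (i : 'I_2) :
  triple x y w 0 (lshift n.+1 i) = if i == 0 then x else y.
Proof. by rewrite row_mxEl mxE. Qed.

Lemma triple_rshift (x y : R) (w : vec) i : triple x y w 0 (rshift 2 i) = w 0 i.
Proof. by rewrite row_mxEr. Qed.

Lemma triple_inj (x y x' y' : R) (w w' : vec) :
  triple x y w = triple x' y' w' -> [/\ x = x', y = y' & w = w'].
Proof.
move=> /eq_row_mx[/rowP E1 ->]; split=> //.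
  by have := E1 0; rewrite !mxE.
by have := E1 1; rewrite !mxE.
Qed.

Lemma dotp_triple (x y x' y' : R) (w w' : vec) :
  dotp (triple x y w) (triple x' y' w') = x * x' + y * y' + dotp w w'.
Proof.
rewrite dotp_row_mx; congr (_ + _).
by rewrite /dotp big_ord_recl big_ord1 !mxE.
Qed.

Lemma mxact_closed (B : 'M[R]_n.+1) (x y : R) (w : vec) :
  mxact (closed_mx B) (triple x y w) = triple y x (mxact B w).
Proof.
rewrite /mxact /closed_mx /triple tr_block_mx !trmx0 mul_row_block !mulmx0 addr0 add0r.
congr row_mx; apply/rowP => i; rewrite !mxE big_ord_recl big_ord1 !mxE /=.
case: (ordP2 i) => ->; by rewrite ?mulr1 ?mulr0 ?addr0 ?add0r.
Qed.

Lemma is_derive_triple E (a b : E -> R) (c : E -> vec) x v da db dc :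
  is_derive x v a da -> is_derive x v b db -> is_derive x v c dc ->
  is_derive x v (fun y => triple (a y) (b y) (c y)) (triple da db dc).
Proof.
move=> ad bd cd; apply: derive_row_mx (cd); apply: is_derive_rowP => i.
rewrite mxE; under eq_fun do rewrite mxE.
by case: (i == 0).
Qed.

Lemma Ck_triple E k (D : set E) (a b : E -> R) (c : E -> vec) : open D ->
  Ck_on k D a -> Ck_on k D b -> Ck_on k D c ->
  Ck_on k D (fun y => triple (a y) (b y) (c y)).
Proof.
move=> Do ak bk ck; apply: Ck_row_mx => //; apply/(Ck_rowP _ _ Do) => i.
under eq_fun do rewrite mxE.
by case: (i == 0).
Qed.

End Triple.

Lemma derive_comp E m (D : set 'rV[R]_m) (f : 'rV[R]_m -> R) (g : E -> 'rV[R]_m) x w :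
  open D -> Ck_on 1 D f -> D (g x) -> derivable g x w ->
  is_derive x w (fun y => f (g y)) ('D_('D_w g x) f (g x)).
Proof.
move=> Do f1 Dgx gd; apply: is_derive_eq (chain_rule Do f1 Dgx gd) _.
by have [_ ->] := C1_differentiable Do f1 Dgx.
Qed.

Lemma derive_comp_row E m p (D : set 'rV[R]_m) (f : 'rV[R]_m -> 'rV[R]_p)
    (g : E -> 'rV[R]_m) x w :
  open D -> Ck_on 1 D f -> D (g x) -> derivable g x w ->
  is_derive x w (fun y => f (g y)) ('D_('D_w g x) f (g x)).
Proof.
move=> Do f1 Dgx gd; apply: is_derive_rowP => i.
rewrite -derive_coord; last exact: derivable_Ck f1 Dgx.
exact: derive_comp Do ((Ck_rowP _ _ Do).1 f1 i) Dgx gd.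
Qed.

End Preliminaries.

(** * Scalar identities *)

Lemma subr_eq_opp (V : zmodType) (a b d : V) : a - d = - b -> d = a + b.
Proof. by move/eqP; rewrite subr_eq => /eqP ->; rewrite addrAC addNr add0r. Qed.

Lemma first_integral_arith (R : realType) (d h q l m : R) :
  d - (h + q + l) = m -> d - h = m + q + l.
Proof. by move=> <-; ring. Qed.

Lemma lagr_arith (R : realType) (d h q l m : R) :
  d - h = m + q + l -> h + q + l + m = d.
Proof. by move=> H; rewrite -[d](subrK h) H; ring. Qed.

(** For [action_density]: [X] and [dX] stand for Xi and its derivative, [wm] for
U_x . m with m the momentum, [dwm] for the variation of U_x paired with m, [ddwm]
for the y-derivative of the variation of U paired with m, [g] and [bq] for the
variation of U paired with the gradient of the density and with B^-1 U. *)
Lemma action_density_arith (R : realType) (X dX wm dwm ddwm g c bq l cv Q lv mv : R) :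
  X * dwm = ddwm - dX * wm ->
  dX * wm + X * (g + dwm + (cv * Q + c * bq) + (lv + l) + mv) =
  X * (g + (c * bq + l)) + ddwm + X * (mv + cv * Q + lv).
Proof.
move=> H; have -> : ddwm = X * dwm + dX * wm by rewrite H subrK.
ring.
Qed.

(** For [derive_meanH]: the parameter variations [m], [cv], [lw] of mu, c and
lam . M cancel as soon as [k * X = 1]. *)
Lemma derive_meanH_arith (R : realType)
  (k X T dk m c cv a da Q b dl lw : R) : k * X = 1 ->
  k * (X * (m + cv * (k * a + Q) + lw)) + T * dk
   - (c * (k * da + a * dk + b) + (k * a + Q) * cv + (lw + dl) + m) =
  (T - a * c) * dk + - (k * c) * da + - (c * b + dl).
Proof. by move=> kX; rewrite mulrA kX; ring. Qed.

Lemma Q_flux_arith (R : realType) (c d l m : R) :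
  - (c * d + l) + (m + c * (2^-1 * d) + l) = m + - c * (2^-1 * d) + 0.
Proof. by rewrite -{1}(half_double d); ring. Qed.

Lemma lagr_reorder (R : realType) (h q l m : R) :
  h + q + l + m = h + (m + q + l).
Proof. ring. Qed.

(** For [modulated_closed]: left, the equation for <Q>, with the values of the
time derivatives of k and M given by the first two equations; right, [k] times
the equation for alpha. *)
Lemma alpha_equation_arith (R : realType) (k X c c' k' a a' ta Q b l m : R) :
  k * X = 1 ->
  k * ta + a * - (k * c' + c * k') + - (c' * (2 * Q) + c * b + l)
  - (m - (c * (k * a' + a * k' + b) + (k * a + Q) * c')) =
  k * (ta - (X * (m + c' * (k * a + Q) + l) - (a * c' + c * a'))).
Proof.
move=> kX; rewrite !mulrBr [k * (X * _)]mulrA kX; ring.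
Qed.

Lemma scale_eq_sub (R : realType) m (x d : R) (a b c : 'rV[R]_m) :
  (forall i, b 0 i = x * a 0 i + d * c 0 i) -> x *: a = b - d *: c.
Proof. by move=> H; apply/rowP => i; rewrite !mxE H addrK. Qed.

(** * Periodic profiles and the gradient of the action *)

Section Profiles.
Context {R : realType} {n : nat}.
Local Notation vec := ('rV[R]_n.+1).
Local Notation par := ('rV[R]_(2 + n.+1)).
Variables (Omega : set par) (Oo : open Omega).
Variables (U : par -> R -> vec) (Xi : par -> R).
Hypothesis Us : smooth_on (Omega `*` [set: R]) (fun q : par * R => U q.1 q.2).
Hypothesis Xis : smooth_on Omega Xi.
Hypothesis Xi0 : forall p, Omega p -> 0 < Xi p.
Hypothesis Uper : forall p, Omega p -> periodic (U p) (Xi p).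
Variables (S : set vec) (So : open S) (Ham : vec -> vec -> R).
Hypothesis Hams : smooth_on [set w : 'rV[R]_(n.+1 + n.+1) | S (lsubmx w)]
  (fun w => Ham (lsubmx w) (rsubmx w)).
Hypothesis US : forall p x, Omega p -> S (U p x).
Variables (B : 'M[R]_n.+1).
Hypothesis Bu : B \in unitmx.
Hypothesis Bsym : B^T = B.
Hypothesis prof : forall p, Omega p -> profile_equations Ham B p (U p).

Local Notation O := (Omega `*` [set: R]).
Let OO : open O := openXT Oo.

Definition dpar (v : par) : par * R := (v, 0).
Definition dvar : par * R := (0, 1).

Definition Uq (q : par * R) : vec := U q.1 q.2.
Definition Ux : par * R -> vec := 'D_dvar Uq.

(** In the variable y = x / Xi the period is 1 for all parameters, so that
periodicity can be differentiated in the parameters.  The suffix 1 marks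
quantities expressed in that variable. *)
Definition U1 : par * R -> vec := rescale Xi Uq.
Definition Ux1 : par * R -> vec := rescale Xi Ux.

Lemma Ck_Ux k : Ck_on k O Ux.
Proof. exact: Ck_derive (Us k.+1). Qed.

Lemma Ck_U1 k : Ck_on k O U1.
Proof. exact: Ck_rescale (Us k). Qed.

Lemma Ck_Ux1 k : Ck_on k O Ux1.
Proof. exact: Ck_rescale (Ck_Ux k). Qed.

Lemma is_derive_U p (x : R) : Omega p -> is_derive x 1 (U p) (Ux (p, x)).
Proof.
by move=> Op; apply: (is_derive_slice2 (is_derive_Ck dvar (Us 1%N) _)).
Qed.

Lemma derive1_U p (x : R) : Omega p -> derive1 (U p) x = Ux (p, x).
Proof. by move=> Op; rewrite derive1E; case: (is_derive_U x Op). Qed.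

Lemma Ux_periodic p (x : R) : Omega p -> Ux (p, Xi p + x) = Ux (p, x).
Proof.
move=> Op; have := is_derive_translate (is_derive_U (Xi p + x) Op).
have -> : (fun y : R => U p (Xi p + y)) = U p.
  by apply/funext => y; rewrite addrC Uper.
by case=> _ <-; case: (is_derive_U x Op).
Qed.

Lemma U1_periodic p : Omega p -> U1 (p, 1) = U1 (p, 0).
Proof. by move=> Op; rewrite /U1 /rescale /Uq /= mulr1 mulr0 -{1}[Xi p]add0r Uper. Qed.

Lemma Ux1_periodic p : Omega p -> Ux1 (p, 1) = Ux1 (p, 0).
Proof.
by move=> Op; rewrite /Ux1 /rescale /= mulr1 mulr0 -(Ux_periodic 0 Op) addr0.
Qed.

Lemma derive_U1_periodic p v : Omega p -> 'D_(dpar v) U1 (p, 1) = 'D_(dpar v) U1 (p, 0).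
Proof.
move=> Op.
have H (y : R) : 'D_(dpar v) U1 (p, y) = 'D_v (fun q => U1 (q, y)) p.
  have Opy : O (p, y) by [].
  by have [_ ->] := is_derive_slice1 (is_derive_Ck (dpar v) (Ck_U1 1) Opy).
by rewrite !H; apply: eq_derive_on Op => // q; exact: U1_periodic.
Qed.

Lemma derive_U1 q : O q -> 'D_dvar U1 q = Xi q.1 *: Ux1 q.
Proof. by move=> Oq; rewrite (derive_rescale Oo Xis (Us 1%N) Oq). Qed.

(** From [Xi *: Ux1 = 'D_dvar U1] and the symmetry of mixed derivatives. *)
Lemma derive_Ux1 q v : O q ->
  Xi q.1 *: 'D_(dpar v) Ux1 q =
  'D_dvar ('D_(dpar v) U1) q - 'D_v Xi q.1 *: Ux1 q.
Proof.
move=> Oq; have Oq1 : Omega q.1 by case: Oq.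
apply: scale_eq_sub => i.
have Wi k := (Ck_rowP k U1 OO).1 (Ck_U1 k) i.
have Wxi k := (Ck_rowP k Ux1 OO).1 (Ck_Ux1 k) i.
have dWd w q' : O q' -> 'D_w U1 q' 0 i = 'D_w (fun q => U1 q 0 i) q'.
  by move=> Oq'; rewrite derive_coord//; exact: derivable_Ck (Ck_U1 1) Oq'.
have E1 : 'D_dvar ('D_(dpar v) U1) q 0 i = 'D_(dpar v) ('D_dvar (fun q => U1 q 0 i)) q.
  rewrite (schwarz (dpar v) dvar OO (Wi 2%N) Oq) -derive_coord.
    by apply: eq_derive_on Oq => // q'; exact: dWd.
  exact: derivable_Ck (Ck_derive (dpar v) (Ck_U1 2)) Oq.
have E2 : 'D_(dpar v) ('D_dvar (fun q => U1 q 0 i)) q =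
          'D_(dpar v) (fun q => Xi q.1 * Ux1 q 0 i) q.
  apply: eq_derive_on Oq => // q' Oq'; rewrite -dWd// derive_U1//.
  by rewrite mxE.
have dXi : is_derive q (dpar v) (fun q => Xi q.1) ('D_v Xi q.1).
  have Xi1 : Ck_on 1 O (fun q => Xi q.1) by apply: Ck_fst (Xis 1%N).
  have := is_derive_Ck (dpar v) Xi1 Oq.
  case: (q) Oq1 => p y /= Op dX.
  by have [_ ->] := is_derive_slice1 dX.
have [_ E3] := is_deriveM dXi (is_derive_Ck (dpar v) (Wxi 1%N) Oq).
have dWx : 'D_(dpar v) Ux1 q 0 i = 'D_(dpar v) (fun q => Ux1 q 0 i) q.
  by rewrite derive_coord//; exact: derivable_Ck (Ck_Ux1 1) Oq.
apply: etrans E1 (etrans E2 (etrans E3 _)).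
by rewrite dWx; congr (_ + _); exact: mulrC.
Qed.

Local Notation Bi := (mxact (invmx B)).

Lemma U1_in q : O q -> S (U1 q).
Proof. by case: q => p y [/= Op _]; exact: US. Qed.

(** The quadratic term contributes [cc p *: Bi (U p x)] to the variational
derivative and does not involve U_x. *)
Lemma varder_Ham p x : Omega p ->
  varder Ham (U p) x = - (cc p *: Bi (U p x) + lam p).
Proof.
move=> Op; have [EL _] := prof Op; have {EL} := EL x.
set F := fun w wx => Ham w wx + cc p * Qf B w.
have -> : varder F (U p) x = varder Ham (U p) x + cc p *: Bi (U p x).
  rewrite /varder.
  have -> : (fun y => grad (fun w => F (U p y) w) (derive1 (U p) y)) =
            (fun y => grad (fun w => Ham (U p y) w) (derive1 (U p) y)).
    by apply/funext => y; rewrite /F grad_addcst.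
  rewrite addrAC; congr (_ + _); apply/rowP => i; rewrite !mxE.
  have HU : derivable (fun w => Ham w (derive1 (U p) x)) (U p x) (delta_mx 0 i).
    by apply: (derivable_Ham_U So Hams); exact: US.
  have HQ := is_derive_Qf Bsym (is_derive_id (U p x) (delta_mx 0 i)).
  have HQ' := is_deriveZ (cc p) HQ.
  have [_ ->] := is_deriveD (derivableP HU) HQ'.
  congr (_ + _ * _); rewrite /dotp (bigD1 i)//= mxE !eqxx mul1r big1 ?addr0 ?mxE//.
  by move=> j ji; rewrite mxE eqxx (negbTE ji) mul0r.
by rewrite -addrA => /eqP; rewrite addr_eq0 => /eqP.
Qed.

(** The momentum conjugate to U_x. *)
Definition mom (q : par * R) : vec := gradUx Ham (Uq q) (Ux q).
Definition mom1 : par * R -> vec := rescale Xi mom.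

Lemma Ck_mom k : Ck_on k O mom.
Proof.
apply: (Ck_gradUx So Hams) => //; last exact: Ck_Ux.
by move=> [p x] [/= Op _]; exact: US.
Qed.

Lemma Ck_mom1 k : Ck_on k O mom1.
Proof. exact: Ck_rescale (Ck_mom k). Qed.

Lemma euler_lagrange q : O q ->
  'D_dvar mom q = gradU Ham (Uq q) (Ux q) + (cc q.1 *: Bi (Uq q) + lam q.1).
Proof.
case: q => p x Oq; have Op : Omega p by case: Oq.
have := varder_Ham x Op; rewrite /varder.
have -> : (fun y => grad (fun w => Ham (U p y) w) (derive1 (U p) y)) =
          (fun y => mom (p, y)).
  by apply/funext => y; rewrite derive1_U.
have [_ PE] := is_derive_slice2 (is_derive_Ck dvar (Ck_mom 1) Oq).
rewrite (derive1_U x Op) (derive1E (fun y => mom (p, y))) PE.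
exact: subr_eq_opp.
Qed.

Lemma derive_mom1 q : O q ->
  'D_dvar mom1 q =
  Xi q.1 *: (gradU Ham (U1 q) (Ux1 q) + (cc q.1 *: Bi (U1 q) + lam q.1)).
Proof.
move=> Oq; rewrite (derive_rescale Oo Xis (Ck_mom 1) Oq); congr (_ *: _).
have Oq' : O (q.1, Xi q.1 * q.2) by case: Oq.
exact: euler_lagrange Oq'.
Qed.

Lemma mom1_periodic p : Omega p -> mom1 (p, 1) = mom1 (p, 0).
Proof.
move=> Op; rewrite -[LHS]/(gradUx Ham (U1 (p, 1)) (Ux1 (p, 1))).
by rewrite (U1_periodic Op) (Ux1_periodic Op).
Qed.

Lemma Lop_Ham p x : Omega p ->
  Lop Ham (U p) x = mu p + cc p * Qf B (U p x) + dotp (lam p) (U p x).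
Proof.
move=> Op; have [_ /(_ x)] := prof Op; rewrite /Lop.
have -> : grad (fun w => Ham (U p x) w + cc p * Qf B (U p x) + dotp (lam p) (U p x))
    (derive1 (U p) x) = grad (fun w => Ham (U p x) w) (derive1 (U p) x).
  exact: (etrans (grad_addcst (fun w => Ham (U p x) w + cc p * Qf B (U p x)) _ _)
                 (grad_addcst _ _ _)).
exact: first_integral_arith.
Qed.

(** The integrand of the action: the Lagrangian plus the constant mu. *)
Definition lagr (q : par * R) : R :=
  Ham (Uq q) (Ux q) + cc q.1 * Qf B (Uq q) + dotp (lam q.1) (Uq q) + mu q.1.
Definition lagr1 : par * R -> R := rescale Xi lagr.

Lemma Ck_lagrangian k (a b : par * R -> vec) : (forall q, O q -> S (a q)) ->
  Ck_on k O a -> Ck_on k O b ->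
  Ck_on k O (fun q => Ham (a q) (b q) + cc q.1 * Qf B (a q)
                      + dotp (lam q.1) (a q) + mu q.1).
Proof.
move=> aS ak bk.
have fk : Ck_on k O fst by apply: (@Ck_linear _ _ _ k O fst) => // x; exact: cvg_fst.
have Hk := Ck_Ham So Hams OO aS ak bk.
have Qk := CkM OO (Ck_cc OO fk) (Ck_Qf B OO ak).
exact: CkD OO (CkD OO (CkD OO Hk Qk) (Ck_dotp OO (Ck_lam OO fk) ak)) (Ck_mu OO fk).
Qed.

Lemma Ck_lagr k : Ck_on k O lagr.
Proof.
apply: Ck_lagrangian; [|exact: (Us k)|exact: Ck_Ux].
by move=> [p x] [/= Op _]; exact: US.
Qed.

Lemma Ck_lagr1 k : Ck_on k O lagr1.
Proof. exact: Ck_lagrangian U1_in (Ck_U1 k) (Ck_Ux1 k). Qed.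

(** The second profile equation says that the Legendre transform of the Lagrangian
is mu. *)
Lemma lagr1E q : O q -> lagr1 q = dotp (Ux1 q) (mom1 q).
Proof.
case: q => p y Oq; have Op : Omega p by case: Oq.
have := Lop_Ham (Xi p * y) Op; rewrite /Lop (derive1_U _ Op).
exact: lagr_arith.
Qed.

Lemma derive_lagr1 q v : O q -> 'D_(dpar v) lagr1 q =
  dotp ('D_(dpar v) U1 q) (gradU Ham (U1 q) (Ux1 q))
  + dotp ('D_(dpar v) Ux1 q) (mom1 q)
  + (cc v * Qf B (U1 q) + cc q.1 * dotp ('D_(dpar v) U1 q) (Bi (U1 q)))
  + (dotp (lam v) (U1 q) + dotp (lam q.1) ('D_(dpar v) U1 q)) + mu v.
Proof.
move=> Oq.
have dW := is_derive_Ck (dpar v) (Ck_U1 1) Oq.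
have dWx := is_derive_Ck (dpar v) (Ck_Ux1 1) Oq.
have d1 : is_derive q (dpar v) fst v.
  exact: (@is_derive_comp_linear _ _ par par fst id q (dpar v) v (is_derive_id _ _)).
have dH := is_derive_Ham So Hams (U1_in Oq) dW dWx.
have dQ := is_deriveM (is_derive_cc d1) (is_derive_Qf Bsym dW).
have dl := is_derive_dotp (is_derive_lam d1) dW.
have [_ ->] := is_deriveD (is_deriveD (is_deriveD dH dQ) dl) (is_derive_mu d1).
congr (_ + _ + _ + _); rewrite addrC; congr (_ + _); exact: mulrC.
Qed.

(** The heart of Whitham's computation: by the two profile equations the
parameter derivative of the action density is its explicit dependence on the
parameters, up to the total derivative of momentum times variation. *)
Lemma action_density q v : O q ->
  'D_v Xi q.1 * lagr1 q + Xi q.1 * 'D_(dpar v) lagr1 q =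
  'D_dvar (fun q => dotp (mom1 q) ('D_(dpar v) U1 q)) q
  + Xi q.1 * (mu v + cc v * Qf B (U1 q) + dotp (lam v) (U1 q)).
Proof.
move=> Oq; rewrite (lagr1E Oq) (derive_lagr1 v Oq).
have dm := is_derive_Ck dvar (Ck_mom1 1) Oq.
have ddW := is_derive_Ck dvar (Ck_derive (dpar v) (Ck_U1 2)) Oq.
have [_ ->] := is_derive_dotp dm ddW.
rewrite (derive_mom1 Oq).
have := congr1 (dotp (mom1 q)) (derive_Ux1 v Oq).
rewrite dotpDr dotpNr !dotpZr dotpZl !dotpDl dotpZl.
rewrite (dotpC ('D_(dpar v) U1 q) (gradU _ _ _)) (dotpC ('D_(dpar v) Ux1 q)).
rewrite (dotpC ('D_(dpar v) U1 q) (Bi _)) (dotpC (Ux1 q)).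
exact: action_density_arith.
Qed.

Definition avgQ : par -> R := integral_param (fun q => Qf B (U1 q)).
Definition avgU (p : par) : vec := \row_i integral_param (fun q => U1 q 0 i) p.

Let Qk k : Ck_on k O (fun q => Qf B (U1 q)) := Ck_Qf B OO (Ck_U1 k).
Let Wk k i : Ck_on k O (fun q => U1 q 0 i) := (Ck_rowP k U1 OO).1 (Ck_U1 k) i.

Lemma Ck_avgQ k : Ck_on k Omega avgQ.
Proof. exact: Ck_integral_param Oo (Qk k). Qed.

Lemma Ck_avgU k : Ck_on k Omega avgU.
Proof.
apply/(Ck_rowP _ _ Oo) => i.
by apply: eq_Ck (Oo) _ (Ck_integral_param Oo (Wk k i)) => p _; rewrite mxE.
Qed.

Lemma integral_rescale (g0 : par * R -> R) (g : R -> R) p :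
  Ck_on 0 O g0 -> Omega p -> (forall x, g x = g0 (p, x)) ->
  \int[lebesgue_measure]_(x in `[0, Xi p]) g x =
  Xi p * integral_param (rescale Xi g0) p.
Proof.
move=> g0c Op gE; have -> : g = (fun x => g0 (p, x)) by apply/funext.
by rewrite int_rescale ?Xi0// => x; exact: continuous_slice g0c Op.
Qed.

Lemma mean_rescale (g0 : par * R -> R) (g : R -> R) p :
  Ck_on 0 O g0 -> Omega p -> (forall x, g x = g0 (p, x)) ->
  mean (Xi p) g = integral_param (rescale Xi g0) p.
Proof.
move=> g0c Op gE; rewrite /mean (integral_rescale g0c Op gE) mulKf//.
by rewrite gt_eqF ?Xi0.
Qed.

Lemma actionE p : Omega p -> action Ham B U Xi p = Xi p * integral_param lagr1 p.
Proof.
move=> Op; apply: (integral_rescale (Ck_lagr 0) Op) => x.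
by rewrite (derive1_U x Op).
Qed.

Lemma meanQE p : Omega p -> meanQ B U Xi p = avgQ p.
Proof. by move=> Op; exact: mean_rescale (Ck_Qf B OO (Us 0%N)) Op _. Qed.

Lemma meanUE p : Omega p -> meanU U Xi p = avgU p.
Proof.
move=> Op; apply/rowP => i; rewrite !mxE.
exact: mean_rescale ((Ck_rowP 0 Uq OO).1 (Us 0%N) i) Op _.
Qed.

Lemma meanHE p : Omega p ->
  meanH Ham U Xi p = integral_param (fun q => Ham (U1 q) (Ux1 q)) p.
Proof.
move=> Op; have Hc : Ck_on 0 O (fun q => Ham (Uq q) (Ux q)).
  apply: (Ck_Ham So Hams OO) (Us 0%N) (Ck_Ux 0).
  by move=> [q x] [/= Oq _]; exact: US.
by apply: (mean_rescale Hc Op) => x; rewrite (derive1_U x Op).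
Qed.

Lemma integral_affine (m c : R) (w : vec) p : Omega p ->
  int01 (fun y => m + c * Qf B (U1 (p, y)) + dotp w (U1 (p, y))) =
  m + c * avgQ p + dotp w (avgU p).
Proof.
move=> Op.
have Qc y : {for y, continuous (fun y => Qf B (U1 (p, y)))}.
  exact: continuous_slice (Qk 0) Op.
have Wc i y : {for y, continuous (fun y => U1 (p, y) 0 i)}.
  exact: continuous_slice (Wk 0 i) Op.
have cQc y : {for y, continuous (fun y => c * Qf B (U1 (p, y)))}.
  by apply: continuousM; [exact: cst_continuous|exact: Qc].
have mc (y : R) : {for y, continuous (fun _ : R => m)} by exact: cst_continuous.
have fk : Ck_on 0 O (fun q => dotp w (U1 q)) := Ck_dotp OO (Ck_cst 0 w OO) (Ck_U1 0).
have wc y : {for y, continuous (fun y => dotp w (U1 (p, y)))}.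
  exact: continuous_slice fk Op.
rewrite int01D => [|y _|y _]; [|exact: continuousD (mc y) (cQc y)|exact: wc].
rewrite int01D => [|y _|y _]; [|exact: mc|exact: cQc].
rewrite int01_cst int01Z => [|y _]; last exact: Qc.
congr (_ + _ + _); rewrite dotpC -int01_dotp//.
by apply: eq_int01 => y _; rewrite dotpC.
Qed.

(** Integrate [action_density] over a period: the total derivative contributes 0,
because momentum and variation of the profile have period 1. *)
Lemma is_derive_action p v : Omega p ->
  is_derive p v (action Ham B U Xi)
    (Xi p * (mu v + cc v * avgQ p + dotp (lam v) (avgU p))).
Proof.
move=> Op.
have Oy (y : R) : O (p, y) by [].
have near_action : \forall q \near p, Xi q * integral_param lagr1 q = action Ham B U Xi q.
  by apply: near_eq_on Oo _ Op => q Oq; rewrite actionE.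
apply: near_eq_is_derive near_action _.
have dL := is_derive_integral_param v Oo (Ck_lagr1 1) Op.
apply: is_derive_eq (is_deriveM (is_derive_Ck v (Xis 1%N) Op) dL) _.
have lc (y : R) : {for y, continuous (fun y => lagr1 (p, y))}.
  exact: continuous_slice (Ck_lagr1 0) Op.
have dlc (y : R) : {for y, continuous (fun y => 'D_(dpar v) lagr1 (p, y))}.
  exact: continuous_slice (Ck_derive (dpar v) (Ck_lagr1 1)) Op.
pose M q := dotp (mom1 q) ('D_(dpar v) U1 q).
have M1 : Ck_on 1 O M := Ck_dotp OO (Ck_mom1 1) (Ck_derive (dpar v) (Ck_U1 2)).
have Mc (y : R) : {for y, continuous (fun y => 'D_dvar M (p, y))}.
  exact: continuous_slice (Ck_derive dvar M1) Op.
have MI : int01 (fun y => 'D_dvar M (p, y)) = 0.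
  have dM (y : R) := is_derive_slice2 (is_derive_Ck dvar M1 (Oy y)).
  rewrite (int01_derive (fun y _ => Mc y) dM).
  by rewrite /M (mom1_periodic Op) (derive_U1_periodic v Op) subrr.
have ac (y : R) : {for y, continuous
    (fun y => mu v + cc v * Qf B (U1 (p, y)) + dotp (lam v) (U1 (p, y)))}.
  have ak := CkD OO (CkD OO (Ck_cst 0 (mu v) OO) (CkM OO (Ck_cst 0 (cc v) OO) (Qk 0)))
    (Ck_dotp OO (Ck_cst 0 (lam v) OO) (Ck_U1 0)).
  exact: continuous_slice ak Op.
have A1 : 'D_v Xi p * integral_param lagr1 p =
    int01 (fun y => 'D_v Xi p * lagr1 (p, y)) by rewrite int01Z.
have A2 : Xi p * integral_param ('D_(dpar v) lagr1) p =
    int01 (fun y => Xi p * 'D_(dpar v) lagr1 (p, y)) by rewrite int01Z.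
rewrite addrC -[_ *: 'D_v Xi p]mulrC -[Xi p *: _]/(Xi p * _).
rewrite [X in X + _]A1 [X in _ + X]A2 -(integral_affine _ _ _ Op) -int01Z//.
have sc (a : R) (g : R -> R) : (forall y : R, {for y, continuous g}) ->
    forall y : R, 0 <= y <= 1 -> {for y, continuous (fun y => a * g y)}.
  by move=> gc y _; apply: continuousM; [exact: cst_continuous|exact: gc].
rewrite -(int01D (sc _ _ lc) (sc _ _ dlc)).
rewrite -[RHS]add0r -MI -(int01D (fun y _ => Mc y) (sc _ _ ac)).
by apply: eq_int01 => y _; exact: (action_density v (Oy y)).
Qed.

Lemma mean_affine (m c : R) (w : vec) (g : R -> R) p : Omega p ->
  (forall x, g x = m + c * Qf B (U p x) + dotp w (U p x)) ->
  mean (Xi p) g = m + c * avgQ p + dotp w (avgU p).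
Proof.
move=> Op gE; rewrite -(integral_affine _ _ _ Op).
have g0k : Ck_on 0 O (fun q => m + c * Qf B (Uq q) + dotp w (Uq q)) :=
  CkD OO (CkD OO (Ck_cst 0 m OO) (CkM OO (Ck_cst 0 c OO) (Ck_Qf B OO (Us 0%N))))
    (Ck_dotp OO (Ck_cst 0 w OO) (Us 0%N)).
exact: mean_rescale g0k Op gE.
Qed.

(** Paired with a fixed vector, the variational derivative is affine in U, hence
commutes with the mean. *)
Let varder_dot p (u r : vec) :
  dotp (- (cc p *: Bi u + lam p)) r = - dotp (lam p) r + dotp (- cc p *: Bi r) u.
Proof.
rewrite dotpNl dotpDl !dotpZl opprD addrC mulNr; congr (- _ - _ * _).
by rewrite dotpC dotp_mxact_sym// dotpC.
Qed.

Let mean_varder p (r : vec) : Omega p ->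
  mean (Xi p) (fun x => dotp (varder Ham (U p) x) r) =
  dotp (- (cc p *: Bi (avgU p) + lam p)) r.
Proof.
move=> Op; rewrite varder_dot -[- dotp _ _]addr0 -[X in _ + X + _](mul0r (avgQ p)).
apply: (mean_affine Op) => x.
by rewrite (varder_Ham x Op) varder_dot mul0r addr0.
Qed.

Lemma mean_dHE p : Omega p ->
  mean_dH Ham U Xi p = - (cc p *: Bi (avgU p) + lam p).
Proof.
move=> Op; apply/rowP => i.
rewrite -[RHS]dotp_delta -(mean_varder _ Op) mxE; congr (mean _ _).
by apply/funext => x; rewrite dotp_delta.
Qed.

Lemma mean_flux p : Omega p ->
  meanv (Xi p) (fun x => mxact B (varder Ham (U p) x)) = mxact B (mean_dH Ham U Xi p).
Proof.
move=> Op; apply/rowP => i.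
rewrite mxactE (mean_dHE Op) -(mean_varder _ Op) mxE; congr (mean _ _).
by apply/funext => x; rewrite mxactE.
Qed.

(** By the profile equations U . delta H = - 2 c Q(U) - lam . U, and
L H = mu + c Q(U) + lam . U. *)
Lemma mean_Q_flux p : Omega p ->
  mean (Xi p) (fun x => dotp (U p x) (varder Ham (U p) x) + Lop Ham (U p) x) =
  mu p - cc p * avgQ p.
Proof.
move=> Op; rewrite -mulNr -[RHS]addr0 -[X in _ + X](dotp0l (avgU p)).
apply: (mean_affine Op) => x.
rewrite (varder_Ham x Op) (Lop_Ham x Op) dotp0l dotpNr dotpDr dotpZr /Qf.
rewrite (dotpC (U p x) (lam p)); exact: Q_flux_arith.
Qed.

Local Notation Theta := (action Ham B U Xi).
Lemma Ck_action k : Ck_on k Omega Theta.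
Proof.
apply: eq_Ck (Oo) _ (CkM Oo (Xis k) (Ck_integral_param Oo (Ck_lagr1 k))) => p Op.
by rewrite (actionE Op).
Qed.

Local Notation kk := (wavenumber Xi).
Local Notation al := (alpha B U Xi).
Local Notation F := (kaM B U Xi).
Local Notation Hav := (meanH Ham U Xi).
Local Notation mdH := (mean_dH Ham U Xi).

(** * The averaged Hamiltonian and the modulated equations *)

Lemma kk_neq0 p : Omega p -> kk p != 0.
Proof. by move=> Op; rewrite invr_eq0 gt_eqF ?Xi0. Qed.

Lemma Ck_kk k : Ck_on k Omega kk.
Proof. by apply: CkV => // p Op; rewrite gt_eqF ?Xi0. Qed.

Lemma alE p : Omega p -> al p = Xi p * (avgQ p - Qf B (avgU p)).
Proof. by move=> Op; rewrite /alpha /wavenumber invrK meanQE// meanUE. Qed.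

Lemma Ck_al k : Ck_on k Omega al.
Proof.
have QWk := Ck_Qf B Oo (Ck_avgU k).
have := CkM Oo (Xis k) (CkD Oo (Ck_avgQ k) (CkM Oo (Ck_cst k (-1 : R) Oo) QWk)).
by apply: eq_Ck (Oo) _ => p Op; rewrite alE//= mulN1r.
Qed.

Lemma avgQE p : Omega p -> avgQ p = kk p * al p + Qf B (avgU p).
Proof.
move=> Op; rewrite alE// /wavenumber mulKf ?subrK//.
by rewrite gt_eqF ?Xi0.
Qed.

Lemma derive_avgQ p v : Omega p -> 'D_v avgQ p =
  kk p * 'D_v al p + al p * 'D_v kk p + dotp ('D_v avgU p) (Bi (avgU p)).
Proof.
move=> Op; have dk := is_derive_Ck v (Ck_kk 1) Op.
have da := is_derive_Ck v (Ck_al 1) Op.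
have dW := is_derive_Ck v (Ck_avgU 1) Op.
rewrite (eq_derive_on v Oo avgQE Op).
by have [_ ->] := is_deriveD (is_deriveM dk da) (is_derive_Qf Bsym dW).
Qed.

Lemma kaME p : Omega p -> F p = triple (kk p) (al p) (avgU p).
Proof. by move=> Op; rewrite /kaM meanUE. Qed.

Lemma Ck_kaM k : Ck_on k Omega F.
Proof.
apply: eq_Ck (Oo) _ (Ck_triple Oo (Ck_kk k) (Ck_al k) (Ck_avgU k)) => p Op.
by rewrite kaME.
Qed.

Lemma derive_kaM p v : Omega p ->
  'D_v F p = triple ('D_v kk p) ('D_v al p) ('D_v avgU p).
Proof.
move=> Op; have dk := is_derive_Ck v (Ck_kk 1) Op.
have da := is_derive_Ck v (Ck_al 1) Op.
have dW := is_derive_Ck v (Ck_avgU 1) Op.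
rewrite (eq_derive_on v Oo kaME Op).
by have [_ ->] := is_derive_triple dk da dW.
Qed.

(** Since [grad Theta = (Xi, Xi <Q>, Xi <U>)] is a function of [kaM], a direction in
which [kaM] is stationary lies in the kernel of the Hessian. *)
Lemma kaM_immersion p v : Omega p -> hessian Theta p \in unitmx ->
  'D_v F p = 0 -> v = 0.
Proof.
move=> Op Hu; rewrite derive_kaM// => dF0.
have dF0' : triple ('D_v kk p) ('D_v al p) ('D_v avgU p) = triple 0 0 0.
  rewrite dF0; apply/rowP => i; case: (split_ordP i) => i' ->.
    by rewrite triple_lshift mxE if_same.
  by rewrite triple_rshift !mxE.
have [dk da dW] := triple_inj dF0'.
have dQ : 'D_v avgQ p = 0.
  by rewrite derive_avgQ// dk da dW !mulr0 addr0 add0r dotp0l.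
have dX : 'D_v Xi p = 0.
  have XE q : Omega q -> Xi q = (kk q)^-1 by move=> _; rewrite /wavenumber invrK.
  rewrite (eq_derive_on v Oo XE Op) deriveV ?kk_neq0//.
    by rewrite dk scaler0.
  exact: derivable_Ck (Ck_kk 1) Op.
pose J e q := Xi q * (mu e + cc e * avgQ q + dotp (lam e) (avgU q)).
have JE e q : Omega q -> 'D_e Theta q = J e q.
  by move=> Oq; have [_ ->] := is_derive_action e Oq.
have Jk e k : Ck_on k Omega (J e).
  apply: CkM (Oo) (Xis k) _; apply: CkD (Oo) (CkD Oo _ _) _.
  - exact: Ck_cst.
  - by apply: CkM => //; [exact: Ck_cst|exact: Ck_avgQ].
  - by apply: Ck_dotp => //; [exact: Ck_cst|exact: Ck_avgU].
have dJ e : 'D_v (J e) p = 0.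
  have dXi := is_derive_Ck v (Xis 1%N) Op.
  have dmQ := is_derive_Ck v (Ck_avgQ 1) Op.
  have dmW := is_derive_Ck v (Ck_avgU 1) Op.
  have dl := is_derive_dotp (is_derive_cst (lam e) p v) dmW.
  have dq := is_deriveM (is_derive_cst (cc e) p v) dmQ.
  have [_ ->] := is_deriveM dXi
    (is_deriveD (is_deriveD (is_derive_cst (mu e) p v) dq) dl).
  by rewrite dX dQ dW dotp0l dotp0r !scaler0 !addr0 scaler0.
have : v *m hessian Theta p = 0.
  apply/rowP => j; rewrite mxE [RHS]mxE.
  have [_ /(_ v) dJv] := C1_differentiable Oo (Jk (delta_mx 0 j) 1%N) Op.
  rewrite -[RHS](dJ (delta_mx 0 j)) dJv; apply: eq_bigr => i _.
  by rewrite !mxE (eq_derive_on _ Oo (JE (delta_mx 0 j)) Op).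
by move=> /(congr1 (mulmx^~ (invmx (hessian Theta p)))); rewrite mulmxK// mul0mx.
Qed.

(** Whitham's Legendre relation, from the definition of the action. *)
Lemma meanHE_action p : Omega p ->
  Hav p = kk p * Theta p - (cc p * avgQ p + dotp (lam p) (avgU p) + mu p).
Proof.
move=> Op; rewrite (actionE Op) /wavenumber mulKf ?gt_eqF ?Xi0//.
rewrite (meanHE Op) [_ + mu p]addrC addrA -(integral_affine _ _ _ Op).
have Hk := Ck_Ham So Hams OO U1_in (Ck_U1 0) (Ck_Ux1 0).
have fk : Ck_on 0 O (fun q => mu p + cc p * Qf B (U1 q) + dotp (lam p) (U1 q)) :=
  CkD OO (CkD OO (Ck_cst 0 (mu p) OO) (CkM OO (Ck_cst 0 (cc p) OO) (Qk 0)))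
    (Ck_dotp OO (Ck_cst 0 (lam p) OO) (Ck_U1 0)).
have Hc y (_ : 0 <= y <= 1) := continuous_slice (y := y) Hk Op.
have fc y (_ : 0 <= y <= 1) := continuous_slice (y := y) fk Op.
have -> : integral_param lagr1 p =
    int01 (fun y => Ham (U1 (p, y)) (Ux1 (p, y)) +
      (mu p + cc p * Qf B (U1 (p, y)) + dotp (lam p) (U1 (p, y)))).
  by apply: eq_int01 => y _; exact: lagr_reorder.
by rewrite (int01D Hc fc) addrK.
Qed.

Lemma Ck_meanH k : Ck_on k Omega Hav.
Proof.
apply: eq_Ck (Oo) _ (Ck_integral_param Oo (Ck_Ham So Hams OO U1_in (Ck_U1 k) (Ck_Ux1 k))).
by move=> p Op; rewrite meanHE.
Qed.

(** The gradient of the averaged Hamiltonian in the variables (k, alpha, M),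
expressed in the parameters. *)
Definition gradH (p : par) : par := triple (Theta p - al p * cc p) (- (kk p * cc p)) (mdH p).

(** In the derivative of [meanHE_action], the gradient of the action cancels the
variations of mu, c and lam. *)
Lemma derive_meanH p v : Omega p -> 'D_v Hav p = dotp (gradH p) ('D_v F p).
Proof.
move=> Op; rewrite derive_kaM// dotp_triple (eq_derive_on v Oo meanHE_action Op).
have dk := is_derive_Ck v (Ck_kk 1) Op.
have dQ := is_derive_Ck v (Ck_avgQ 1) Op.
have dW := is_derive_Ck v (Ck_avgU 1) Op.
have d1 := is_derive_id p v.
have [_ ->] := is_deriveB (is_deriveM dk (is_derive_action v Op))
  (is_deriveD (is_deriveD (is_deriveM (is_derive_cc d1) dQ)
    (is_derive_dotp (is_derive_lam d1) dW)) (is_derive_mu d1)).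
rewrite (derive_avgQ v Op) (avgQE Op) (mean_dHE Op) dotpNl dotpDl dotpZl.
rewrite (dotpC (Bi _)) /=.
have kX : kk p * Xi p = 1 by rewrite /wavenumber mulVf// gt_eqF ?Xi0.
exact: derive_meanH_arith kX.
Qed.

(** In the variables (k, alpha, M) the gradient of the averaged Hamiltonian is
[gradH], because the derivative of the inverse undoes that of [kaM]. *)
Lemma grad_meanH_inverse V G p : V `<=` Omega -> diffeo_on V F G -> V p ->
  differentiable (Hav \o G) (F p) /\ grad (Hav \o G) (F p) = gradH p.
Proof.
move=> VO [Vo FVo Fs Gs GF] Vp; have Op := VO _ Vp.
have FVp : (F @` V) (F p) by exists p.
have GV y : (F @` V) y -> V (G y) by case=> x Vx <-; rewrite GF.
have HG : Ck_on 1 (F @` V) (Hav \o G).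
  exact: Ck_comp FVo Vo GV (sub_Ck VO (Ck_meanH 1)) (Gs 1%N).
split; first by have [] := C1_differentiable FVo HG FVp.
apply/rowP => i; rewrite mxE; set e := delta_mx 0 i.
have Gd : derivable G (F p) e by exact: derivable_Ck (Gs 1%N) FVp.
have GFp : Omega (G (F p)) by rewrite GF.
have [_ ->] := derive_comp Oo (Ck_meanH 1) GFp Gd.
have [_ FG] := derive_comp_row Oo (Ck_kaM 1) GFp Gd.
have GFe : G (F p) = p := GF _ Vp.
rewrite GFe in FG; rewrite GFe (derive_meanH _ Op) -FG.
have -> : 'D_e (fun y => F (G y)) (F p) = e.
  transitivity ('D_e id (F p)); last by case: (is_derive_id (F p) e).
  by apply: eq_derive_on FVo _ FVp => y [x Vx <-]; rewrite (GF _ Vx).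
exact: dotp_delta.
Qed.

Lemma is_derive_mdH p v : Omega p ->
  is_derive p v mdH (- (cc v *: Bi (avgU p) + cc p *: Bi ('D_v avgU p) + lam v)).
Proof.
move=> Op; have d1 := is_derive_id p v.
have dW := is_derive_mxact (invmx B) (is_derive_Ck v (Ck_avgU 1) Op).
have near_mdH : \forall q \near p, - (cc q *: Bi (avgU q) + lam q) = mdH q.
  by apply: near_eq_on Oo _ Op => q Oq; rewrite mean_dHE.
apply: near_eq_is_derive near_mdH _.
exact: is_deriveN (is_deriveD (is_derive_scalev (is_derive_cc d1) dW) (is_derive_lam d1)).
Qed.

Lemma Ck_mdH k : Ck_on k Omega mdH.
Proof.
have fk : Ck_on k Omega id by apply: (@Ck_linear _ _ _ k Omega idfun) => // x; exact: cvg_id.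
have Bk := Ck_mxact (invmx B) Oo (Ck_avgU k).
apply/(Ck_rowP _ _ Oo) => i.
have := CkM Oo (Ck_cst k (-1 : R) Oo) (CkD Oo
  (CkM Oo (Ck_cc Oo fk) ((Ck_rowP _ _ Oo).1 Bk i))
  ((Ck_rowP _ _ Oo).1 (Ck_lam Oo fk) i)).
apply: eq_Ck (Oo) _ => p Op; rewrite mean_dHE// !mxE /= mulN1r.
by rewrite !mxE.
Qed.

(** Given the first two modulated equations, the third one is [k] times the
equation for alpha: expand the derivative of <Q> = k alpha + Q(M). *)
Lemma modulated_closed (D : set (R * R)) (P : R * R -> par) V G z :
  open D -> smooth_on D P -> (forall z, D z -> Omega (P z)) -> D z ->
  V `<=` Omega -> diffeo_on V F G -> V (P z) ->
  modulated_eqs Ham B U Xi P z <-> closed_eqs Ham B U Xi G P z.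
Proof.
move=> Do Ps PO Dz VO VFG VPz.
have Op : Omega (P z) := PO _ Dz; set p := P z in Op VPz.
have dirs (w : R * R) : exists v,
    (forall f : par -> R, Ck_on 1 Omega f ->
       'D_w (fun s => f (P s)) z = 'D_v f p) /\
    (forall m (f : par -> 'rV[R]_m), Ck_on 1 Omega f ->
       'D_w (fun s => f (P s)) z = 'D_v f p).
  have Pd : derivable P z w by exact: derivable_Ck (Ps 1%N) Dz.
  exists ('D_w P z); split=> [f f1|m f f1].
    by have [] := derive_comp Oo f1 Op Pd.
  by have [] := derive_comp_row Oo f1 Op Pd.
have [vT [sT wT]] := dirs (0, 1); have [vX [sX wX]] := dirs (1, 0).
have onD (T : normedModType R) (f g : par -> T) w :
    (forall q, Omega q -> f q = g q) ->
    'D_w (fun s => f (P s)) z = 'D_w (fun s => g (P s)) z.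
  by move=> fg; apply: eq_derive_on Do _ Dz => s Ds; apply/fg/PO.
have fk : Ck_on 1 Omega id by apply: (@Ck_linear _ _ _ 1 Omega idfun) => // x; exact: cvg_id.
pose A1 q := - (kk q * cc q).
have A1k : Ck_on 1 Omega A1.
  have := CkM Oo (Ck_cst 1 (-1 : R) Oo) (CkM Oo (Ck_kk 1) (Ck_cc Oo fk)).
  by apply: eq_Ck (Oo) _ => q _; rewrite /A1 /= mulN1r.
pose A3 q := mu q - cc q * avgQ q.
have d1 := is_derive_id p vX.
have dk := is_derive_Ck vX (Ck_kk 1) Op.
have da := is_derive_Ck vX (Ck_al 1) Op.
have dQ := is_derive_Ck vX (Ck_avgQ 1) Op.
have A3k : Ck_on 1 Omega A3.
  have := CkD Oo (Ck_mu Oo fk) (CkM Oo (Ck_cst 1 (-1 : R) Oo) (CkM Oo (Ck_cc Oo fk) (Ck_avgQ 1))).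
  by apply: eq_Ck (Oo) _ => q _; rewrite /A3 /= mulN1r.
have dA1 : is_derive p vX A1 (- (kk p * cc vX + cc p * 'D_vX kk p)).
  exact: is_deriveN (is_deriveM dk (is_derive_cc d1)).
have dA3 : is_derive p vX A3 (mu vX - (cc p * 'D_vX avgQ p + avgQ p * cc vX)).
  exact: is_deriveB (is_derive_mu d1) (is_deriveM (is_derive_cc d1) dQ).
pose A0 q := Theta q - al q * cc q.
have A0k : Ck_on 1 Omega A0.
  have := CkD Oo (Ck_action 1) (CkM Oo (Ck_cst 1 (-1 : R) Oo) (CkM Oo (Ck_al 1) (Ck_cc Oo fk))).
  by apply: eq_Ck (Oo) _ => q _; rewrite /A0 /= mulN1r.
have dA0 : is_derive p vX A0
    (Xi p * (mu vX + cc vX * avgQ p + dotp (lam vX) (avgU p))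
     - (al p * cc vX + cc p * 'D_vX al p)).
  exact: is_deriveB (is_derive_action vX Op) (is_deriveM da (is_derive_cc d1)).
have dmd := is_derive_mdH vX Op.
set a1 := - (kk p * _ + _) in dA1; set a3 := mu vX - _ in dA3.
set a0 := _ - (al p * _ + _) in dA0; set dm := - _ in dmd.
have c1 : dT (fun s => F (P s)) z = triple ('D_vT kk p) ('D_vT al p) ('D_vT avgU p).
  by rewrite -(derive_kaM vT Op); exact: (wT _ F (Ck_kaM 1)).
have c2 : dX (fun s => grad (Hav \o G) (F (P s))) z = triple a0 a1 dm.
  have GHk : Ck_on 1 Omega gradH := Ck_triple Oo A0k A1k (Ck_mdH 1).
  have [_ dGH] : is_derive p vX gradH (triple a0 a1 dm) := is_derive_triple dA0 dA1 dmd.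
  rewrite -dGH -(wX _ gradH GHk); apply: near_eq_derive.
  have Vn : nbhs p V by case: VFG => Vo _ _ _ _; exact: open_nbhs_nbhs.
  have PV : \forall s \near z, V (P s) := continuous_Ck (Ps 0%N) Dz Vn.
  apply: filterS PV => s Vs.
  by case: (grad_meanH_inverse VO VFG Vs).
have e1 : dT (fun s => kk (P s)) z = 'D_vT kk p := sT kk (Ck_kk 1).
have e1' : dX (fun s => omega Xi (P s)) z = a1.
  by have [_ <-] := dA1; exact: (sX A1 A1k).
have e2 : dT (fun s => meanU U Xi (P s)) z = 'D_vT avgU p.
  by rewrite -(wT _ avgU (Ck_avgU 1)); exact: (onD _ (meanU U Xi) avgU _ meanUE).
have e2' : dX (fun s => meanv (Xi (P s)) (fun x => mxact B (varder Ham (U (P s)) x))) z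
    = mxact B dm.
  have [_ <-] := is_derive_mxact B dmd.
  rewrite -(wX _ (fun q => mxact B (mdH q)) (Ck_mxact B Oo (Ck_mdH 1))).
  exact: (onD _ (fun q => meanv (Xi q) (fun x => mxact B (varder Ham (U q) x))) _ _ mean_flux).
have e3 : dT (fun s => meanQ B U Xi (P s)) z = 'D_vT avgQ p.
  by rewrite -(sT avgQ (Ck_avgQ 1)); exact: (onD _ (meanQ B U Xi) avgQ _ meanQE).
have e3' : dX (fun s => mean (Xi (P s))
    (fun x => dotp (U (P s) x) (varder Ham (U (P s)) x) + Lop Ham (U (P s)) x)) z = a3.
  have [_ <-] := dA3.
  rewrite -(sX A3 A3k); exact: (onD _ (fun q => mean (Xi q)
    (fun x => dotp (U q x) (varder Ham (U q) x) + Lop Ham (U q) x)) A3 _ mean_Q_flux).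
have flux : dotp (mxact B dm) (Bi (avgU p)) =
    - (cc vX * (2 * Qf B (avgU p)) + cc p * dotp ('D_vX avgU p) (Bi (avgU p))
       + dotp (lam vX) (avgU p)).
  rewrite dotpC dotp_mxact Bsym (mxactK Bu Bsym) dotpC /dm dotpNl !dotpDl !dotpZl.
  rewrite (dotpC (Bi (avgU p))) (dotpC (Bi ('D_vX avgU p))) (dotp_mxact_sym Bsym (avgU p) ('D_vX _ _)).
  by rewrite /Qf [2 * _]mulrA mulfV ?mul1r// pnatr_eq0.
have key : 'D_vT kk p = a1 -> 'D_vT avgU p = mxact B dm ->
    'D_vT avgQ p - a3 = kk p * ('D_vT al p - a0).
  move=> H1 H2; rewrite (derive_avgQ vT Op) H1 H2 flux /a3 (derive_avgQ vX Op).
  rewrite /a0 /a1 (avgQE Op).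
  have kX : kk p * Xi p = 1 by rewrite /wavenumber mulVf// gt_eqF ?Xi0.
  exact: alpha_equation_arith kX.
rewrite /modulated_eqs /closed_eqs e1 e1' e2 e2' e3 e3' c1 c2 mxact_closed.
split=> [[/subr0_eq H1 /subr0_eq H2 H3]|/triple_inj[H1 H2 H3]].
  have := key H1 H2; rewrite H3 => /esym/eqP; rewrite mulf_eq0 (negbTE (kk_neq0 Op)) /=.
  by move=> /eqP/subr0_eq H4; rewrite H1 H2 H4.
by split; [rewrite H1 subrr|rewrite H3 subrr|rewrite (key H1 H3) H2 subrr mulr0].
Qed.

End Profiles.

(** * The model *)

Section Model.
Context {R : realType} {n : nat}.

Lemma trmx_Bmx (b : R) : (Bmx n b)^T = Bmx n b.
Proof. by apply/matrixP => i j; rewrite !mxE addnC. Qed.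

Lemma Bmx_unit (b : R) : b != 0 -> Bmx n b \in unitmx.
Proof.
move=> b0; suff /mulmx1_unit[] : Bmx n b *m Bmx n b^-1 = 1%:M by [].
apply/matrixP => i j; rewrite !mxE (bigD1 (rev_ord i))//= !mxE.
rewrite big1 ?addr0 => [|k ki]; last first.
  rewrite mxE ifF ?mul0r//; apply: contraNF ki => /eqP ikn.
  by apply/eqP/val_inj; rewrite /= subSS -[LHS](addKn i) ikn.
have le_in : (i <= n)%N by rewrite -ltnS.
rewrite /= !subSS subnKC// eqxx.
have -> : (n - i + j == n)%N = (i == j).
  by rewrite -[X in _ == X](subnK le_in) eqn_add2l eq_sym.
by case: eqP => _; rewrite ?mulr0// mulfV.
Qed.

Variables (I : set R) (f kappa tau : R -> R).
Hypothesis Io : open I.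
Hypotheses (fs : smooth_on I f) (kappas : smooth_on I kappa) (taus : smooth_on I tau).

Local Notation vec := ('rV[R]_n.+1).
Let S : set vec := [set w | I (w 0 ord0)].

Lemma open_first_coord : open S.
Proof. by apply: open_comp => // w _; exact: coord_continuous. Qed.

Lemma smooth_hamiltonian :
  smooth_on [set w : 'rV[R]_(n.+1 + n.+1) | S (lsubmx w)]
    (fun w => hamiltonian f kappa tau (lsubmx w) (rsubmx w)).
Proof.
move=> k; set D := [set w | _].
pose x (i : 'I_(n.+1 + n.+1)) := dotL (delta_mx 0 i : 'rV[R]_(n.+1 + n.+1)).
have xE i w : x i w = w 0 i by rewrite /x /dotL dotp_delta.
have xc i : continuous (x i) by exact: dotL_continuous.
pose i0 := lshift n.+1 (ord0 : 'I_n.+1).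
have DE : D = x i0 @^-1` I.
  by apply/seteqP; split=> w; rewrite /D /S /= xE mxE.
have Do : open D by rewrite DE; apply: open_comp => // w _; exact: xc.
have ck (g : R -> R) : smooth_on I g -> Ck_on k D (g \o x i0).
  by move=> gs; rewrite DE; exact: Ck_comp_linear (xc i0) Io (gs k).
have xk i : Ck_on k D (x i) by apply: Ck_linear => //; exact: xc.
have sqk i : Ck_on k D (fun w => x i w ^+ 2).
  by apply: eq_Ck (Do) _ (CkM Do (xk i) (xk i)) => w _; rewrite expr2.
have hk : Ck_on k D (cst (2^-1 : R)) by exact: Ck_cst.
have ek : Ck_on k D (fun w => energy f kappa (x i0 w) (x (rshift n.+1 ord0) w)).
  exact: CkD Do (CkM Do (CkM Do hk (ck kappa kappas)) (sqk _)) (ck f fs).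
have tk : Ck_on k D (fun w => 2^-1 * tau (x i0 w) * x (lshift n.+1 ord_max) w ^+ 2
     + energy f kappa (x i0 w) (x (rshift n.+1 ord0) w)).
  exact: CkD Do (CkM Do (CkM Do hk (ck tau taus)) (sqk _)) ek.
rewrite /hamiltonian; case: (n == 0)%N.
  by apply: eq_Ck (Do) _ ek => w _; rewrite !xE !mxE.
by apply: eq_Ck (Do) _ tk => w _; rewrite !xE !mxE.
Qed.

End Model.

Theorem theorem1 (R : realType) (n : nat) (hn : (n < 2)%N)
  (b : R) (hb : b != 0)
  (I : set R) (hIopen : open I) (hIitv : is_interval I)
  (f kappa tau : R -> R)
  (hf : smooth_on I f) (hkappa : smooth_on I kappa) (htau : smooth_on I tau)
  (hkappa_gt0 : forall v, I v -> 0 < kappa v)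
  (htau_gt0 : forall v, I v -> 0 < tau v)
  (Omega : set 'rV[R]_(2 + n.+1)) (hOmega : open Omega)
  (U : 'rV[R]_(2 + n.+1) -> R -> 'rV[R]_n.+1) (Xi : 'rV[R]_(2 + n.+1) -> R)
  (hU : smooth_on (Omega `*` [set: R])
          (fun q : 'rV[R]_(2 + n.+1) * R => U q.1 q.2))
  (hXi : smooth_on Omega Xi)
  (hUI : forall p x, Omega p -> I (U p x 0 ord0))
  (hUprofile : forall p, Omega p ->
     profile_equations (hamiltonian f kappa tau) (Bmx n b) p (U p))
  (hUnonconstant : forall p, Omega p -> exists x y, U p x != U p y)
  (hUperiod : forall p, Omega p -> fundamental_period (U p) (Xi p))
  (hHess : forall p, Omega p ->
     hessian (action (hamiltonian f kappa tau) (Bmx n b) U Xi) p \in unitmx) :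
  let H := hamiltonian f kappa tau in
  let B := Bmx n b in
  let F := kaM B U Xi in
  let Hav := meanH H U Xi in
  [/\ local_diffeo Omega F,
      forall V G, V `<=` Omega -> diffeo_on V F G ->
        forall p, V p ->
          differentiable (Hav \o G) (F p) /\
          grad (Hav \o G) (F p) =
            triple (action H B U Xi p - alpha B U Xi p * cc p)
                   (- (wavenumber Xi p * cc p))
                   (mean_dH H U Xi p)
    & forall (D : set (R * R)) (P : R * R -> 'rV[R]_(2 + n.+1)),
        open D -> smooth_on D P -> (forall z, D z -> Omega (P z)) ->
        (forall z, D z -> modulated_eqs H B U Xi P z) <->
        (forall z, D z ->
           forall V G, V `<=` Omega -> diffeo_on V F G -> V (P z) ->
             closed_eqs H B U Xi G P z)].
Proof.
move=> H B F Hav.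
have Xi0 p (Op : Omega p) : 0 < Xi p by case: (hUperiod p Op).
have Uper p (Op : Omega p) : periodic (U p) (Xi p) by case: (hUperiod p Op).
have So := open_first_coord (n := n) hIopen.
have Hs := smooth_hamiltonian (n := n) hIopen hf hkappa htau.
have Bu : B \in unitmx := Bmx_unit hb.
have Bsym : B^T = B := trmx_Bmx b.
have diffeo : local_diffeo Omega F.
  apply: (inverse_function hOmega).
    move=> k; exact: (Ck_kaM hOmega hU hXi Xi0).
  move=> p v Op; exact: (kaM_immersion hOmega hU hXi Xi0 Uper So Hs hUI
    Bsym hUprofile Op (hHess p Op)).
split; first exact: diffeo.
  move=> V G VO VFG p Vp.
  exact: (grad_meanH_inverse hOmega hU hXi Xi0 Uper So Hs hUI Bsym hUprofile VO VFG Vp).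
move=> D P Do Ps PO.
have equiv z V G Dz VO VFG VPz :=
  @modulated_closed _ _ _ hOmega _ _ hU hXi Xi0 Uper _ So _ Hs hUI _ Bu Bsym hUprofile
    D P V G z Do Ps PO Dz VO VFG VPz.
split=> [mod z Dz V G VO VFG VPz|closed z Dz].
  exact: (equiv z V G Dz VO VFG VPz).1 (mod z Dz).
have [V [G [VPz VO VFG]]] := diffeo _ (PO z Dz).
exact: (equiv z V G Dz VO VFG VPz).2 (closed z Dz V G VO VFG VPz).
Qed.
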